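(* Let $A$ be an algebra, $T$ a separating tilting $A$-module, $B=\mathrm{End}_A(T)$ and $F=\mathrm{Hom}_A(T,-)$. Let $M,N$ be indecomposable $A$-modules in $\mathcal{T}(T)$. If $f\in\Re_A^n(M,N)$ for some $n\geq1$, then $F(f)\in\Re_B^n(F(M),F(N))$. In addition, if $\mathrm{dp}(F(f))=n$, then there is a non-zero path of irreducible morphisms between indecomposable $B$-modules in $\mathcal{Y}(T)$ from $F(M)$ to $F(N)$ of length $n$.
   Context: $k$ is an algebraically closed field; an algebra is a finite dimensional basic $k$-algebra; $\mathrm{mod}\,A$ is the category of finitely generated left $A$-modules. Radical: $\Re_A(X,Y)$ is the set of morphisms $f:X\to Y$ in $\mathrm{mod}\,A$ such that $h'fh$ is not an isomorphism for all indecomposable $M$ and all $h:M\to X$, $h':Y\to M$; powers $\Re_A^n$ are defined inductively, and $\Re_A^\infty=\bigcap_{i\ge1}\Re_A^i$. The depth $\mathrm{dp}(f)$ is $n$ if $f\in\Re^n\setminus\Re^{n+1}$, and $\infty$ if $f\in\Re^\infty$. A morphism $f$ is irreducible if it does not split and $f=gh$ implies $h$ is a split monomorphism or $g$ is a split epimorphism. A non-zero path of irreducible morphisms of length $t$ is a sequence $M_0\to M_1\to\cdots\to M_t$ of $t$ irreducible morphisms between indecomposable modules with non-zero composition. Tilting: $T$ is a tilting $A$-module if $\mathrm{pd}\,T\le1$, $\mathrm{Ext}^1_A(T,T)=0$ and the number of isomorphism classes of indecomposable summands of $T$ equals the number of isomorphism classes of simple $A$-modules. With $B=\mathrm{End}_A(T)$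 (conventions chosen so that $\mathrm{Hom}_A(T,-)$ takes values in $\mathrm{mod}\,B$), put $\mathcal{T}(T)=\{X:\mathrm{Ext}^1_A(T,X)=0\}$, $\mathcal{F}(T)=\{X:\mathrm{Hom}_A(T,X)=0\}$ in $\mathrm{mod}\,A$, and $\mathcal{X}(T)=\{Y:Y\otimes_BT=0\}$, $\mathcal{Y}(T)=\{Y:\mathrm{Tor}_1^B(Y,T)=0\}$ in $\mathrm{mod}\,B$. By the Brenner–Butler theorem $\mathrm{Hom}_A(T,-)$ restricts to an equivalence $\mathcal{T}(T)\to\mathcal{Y}(T)$ and $\mathrm{Ext}^1_A(T,-)$ to an equivalence $\mathcal{F}(T)\to\mathcal{X}(T)$. $T$ is separating if every indecomposable $A$-module lies in $\mathcal{T}(T)$ or in $\mathcal{F}(T)$. *)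

(* Defs.v *)
From HB Require Import structures.
From mathcomp Require Import all_boot all_algebra falgebra.
From mathcomp Require Import boolp.

Set Implicit Arguments.
Unset Strict Implicit.
Unset Printing Implicit Defensive.

Import GRing.Theory.
Local Open Scope ring_scope.
Local Open Scope quotient_scope.

(* Left modules over a ring R are objects of [lmodType R]; right modules are  *)
(* objects of [lmodType R^c].  The category mod R consists of the modules     *)
(* satisfying [fin_gen]; over a finite dimensional algebra these are the      *)
(* finite dimensional ones.                                                   *)

Section ModuleCategory.
Variable R : pzRingType.
Implicit Types X Y Z M N P : lmodType R.

Definition fin_gen X : Prop :=
  exists (n : nat) (v : 'I_n -> X),
    forall x, exists a : 'I_n -> R, x = \sum_i a i *: v i.

Definition zero_mod X : Prop := forall x : X, x = 0.

Definition mod_iso X Y : Prop := exists f : {linear X -> Y}, bijective f.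

Definition indecomposable X : Prop :=
  [/\ fin_gen X, ~ zero_mod X
    & forall Y Z, mod_iso X (Y * Z)%type -> zero_mod Y \/ zero_mod Z].

Definition simple_mod X : Prop :=
  ~ zero_mod X /\
  forall S : {pred X}, submod_closed S ->
    (forall x, (x \in S) = (x == 0)) \/ (forall x, x \in S).

Definition summand Y X : Prop := exists Z, mod_iso X (Y * Z)%type.

Definition direct_sum_of X (n : nat) (P : 'I_n -> lmodType R) : Prop :=
  exists (i_ : forall i, {linear P i -> X}) (p_ : forall i, {linear X -> P i}),
    [/\ forall i x, p_ i (i_ i x) = x,
        forall i j x, i != j -> p_ j (i_ i x) = 0
      & forall x, x = \sum_i i_ i (p_ i x)].

Definition number_iso_classes (C : lmodType R -> Prop) (n : nat) : Prop :=
  exists S : 'I_n -> lmodType R,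
    [/\ forall i, C (S i),
        forall i j, mod_iso (S i) (S j) -> i = j
      & forall X, C X -> exists i, mod_iso X (S i)].

Definition radical X Y (f : {linear X -> Y}) : Prop :=
  forall M (h : {linear M -> X}) (h' : {linear Y -> M}),
    indecomposable M -> ~ bijective (h' \o f \o h).

(* Powers of the ideal [radical]: as usual for products of ideals, elements of    *)
(* the (n+1)-st power are finite sums of composites.                          *)
Fixpoint rad_pow (n : nat) : forall X Y, {linear X -> Y} -> Prop :=
  match n with
  | 0 => fun X Y _ => True
  | 1 => fun X Y f => radical f
  | m.+1 => fun X Y f =>
      exists (q : nat) (Z : 'I_q -> lmodType R)
             (h : forall i, {linear X -> Z i}) (g : forall i, {linear Z i -> Y}),
        (forall i, [/\ fin_gen (Z i), rad_pow m (h i) & radical (g i)]) /\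
        (forall x, f x = \sum_i g i (h i x))
  end.

(* [depth f (Some n)] means dp(f) = n, [depth f None] that it is infinite. *)
Definition depth X Y (f : {linear X -> Y}) (n : option nat) : Prop :=
  match n with
  | Some m => rad_pow m f /\ ~ rad_pow m.+1 f
  | None => forall i, (0 < i)%N -> rad_pow i f
  end.

Definition split_mono X Y (f : {linear X -> Y}) : Prop :=
  exists r : {linear Y -> X}, cancel f r.

Definition split_epi X Y (f : {linear X -> Y}) : Prop :=
  exists s : {linear Y -> X}, cancel s f.

Definition irreducible_mor X Y (f : {linear X -> Y}) : Prop :=
  [/\ ~ split_mono f, ~ split_epi f
    & forall Z (h : {linear X -> Z}) (g : {linear Z -> Y}),
        fin_gen Z -> f =1 g \o h -> split_mono h \/ split_epi g].

(* [irr_path C t f]: f is the composition of a path of t irreducible          *)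
(* morphisms between modules in C (end points included).                      *)
Inductive irr_path (C : lmodType R -> Prop) :
    nat -> forall X Y, {linear X -> Y} -> Prop :=
| IrrPath0 X : C X -> irr_path C 0%N (idfun : {linear X -> X})
| IrrPathS t X Z Y (f : {linear X -> Z}) (g : {linear Z -> Y}) :
    C X -> irreducible_mor f -> irr_path C t g ->
    irr_path C t.+1 (g \o f : {linear X -> Y}).

Definition projective P : Prop :=
  forall X Y (g : {linear X -> Y}) (f : {linear P -> Y}),
    (forall y, exists x, g x = y) -> exists h : {linear P -> X}, f =1 g \o h.

Record proj_resolution X := ProjResolution {
  res_obj :> nat -> lmodType R;
  res_diff : forall n, {linear res_obj n.+1 -> res_obj n};
  res_aug : {linear res_obj 0%N -> X};
  _ : forall n, fin_gen (res_obj n);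
  _ : forall n, projective (res_obj n);
  _ : forall x, exists y, res_aug y = x;
  _ : forall y, res_aug y = 0 <-> exists z, res_diff 0%N z = y;
  _ : forall n y, res_diff n y = 0 <-> exists z, res_diff n.+1 z = y
}.

Definition pd_le X (d : nat) : Prop :=
  exists P : proj_resolution X, forall n, (d < n)%N -> zero_mod (P n).

(* Ext^1(X, Y) = 0, i.e. H^1(Hom(P, Y)) = 0 for a projective resolution P of  *)
(* X; the choice of P is irrelevant by the comparison theorem.                *)
Definition Ext1_zero X Y : Prop :=
  exists P : proj_resolution X,
    forall phi : {linear P 1%N -> Y},
      (forall z, phi (res_diff P 1%N z) = 0) ->
      exists psi : {linear P 0%N -> Y}, phi =1 psi \o res_diff P 0%N.

End ModuleCategory.

(* Hom_R(T, X) as an abelian group; equality is pointwise by functional and   *)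
(* propositional extensionality.                                              *)
Section Hom.
Variables (R : pzRingType) (T : lmodType R).

Definition homR (X : lmodType R) : Type := {linear T -> X}.
Identity Coercion linear_of_hom : homR >-> GRing.Linear.type.

HB.instance Definition _ X := gen_eqMixin (homR X).
HB.instance Definition _ X := gen_choiceMixin (homR X).

Lemma homP X (f g : homR X) : (forall x, f x = g x) -> f = g.
Proof.
case: f g => [f [[f1] [f2]]] [g [[g1] [g2]]] /= fg.
have {}fg : f = g by apply: funext.
move: f1 f2 g1 g2; rewrite fg => f1 f2 g1 g2.
by rewrite (Prop_irrelevance f1 g1) (Prop_irrelevance f2 g2).
Qed.

Section Zmod.
Variable X : lmodType R.
Definition hom_zero : homR X := (\0 : T -> X).
Definition hom_opp (f : homR X) : homR X := (\- f : T -> X).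
Definition hom_add (f g : homR X) : homR X := (f \+ g : T -> X).

Lemma hom_addA : associative hom_add.
Proof. by move=> f g h; apply: homP => x /=; rewrite addrA. Qed.
Lemma hom_addC : commutative hom_add.
Proof. by move=> f g; apply: homP => x /=; rewrite addrC. Qed.
Lemma hom_add0 : left_id hom_zero hom_add.
Proof. by move=> f; apply: homP => x /=; rewrite add0r. Qed.
Lemma hom_addN : left_inverse hom_zero hom_opp hom_add.
Proof. by move=> f; apply: homP => x /=; rewrite addNr. Qed.

HB.instance Definition _ :=
  GRing.isZmodule.Build (homR X) hom_addA hom_addC hom_add0 hom_addN.
End Zmod.

End Hom.

(* End_R(T), with composition of maps as multiplication. *)
Section Endo.
Variables (R : pzRingType) (T : lmodType R).

Definition endo : Type := homR T T.
Identity Coercion hom_of_endo : endo >-> homR.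
HB.instance Definition _ := GRing.Zmodule.on endo.

Definition endo_one : endo := (idfun : T -> T).
Definition endo_mul (f g : endo) : endo := (f \o g : T -> T).

Lemma endo_mulA : associative endo_mul.
Proof. by move=> f g h; apply: homP. Qed.
Lemma endo_mul1 : left_id endo_one endo_mul.
Proof. by move=> f; apply: homP. Qed.
Lemma endo_mulr1 : right_id endo_one endo_mul.
Proof. by move=> f; apply: homP. Qed.
Lemma endo_mulDl : left_distributive endo_mul +%R.
Proof. by move=> f g h; apply: homP. Qed.
Lemma endo_mulDr : right_distributive endo_mul +%R.
Proof. by move=> f g h; apply: homP => x /=; rewrite raddfD. Qed.

HB.instance Definition _ := GRing.Zmodule_isPzRing.Build endo
  endo_mulA endo_mul1 endo_mulr1 endo_mulDl endo_mulDr.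

(* T itself as a left module over End_R(T). *)
Definition endo_mod : Type := T.
HB.instance Definition _ := GRing.Zmodule.on endo_mod.

Definition endo_scale (b : endo) (t : endo_mod) : endo_mod := b t.

Lemma endo_scaleA b c t :
  endo_scale b (endo_scale c t) = endo_scale (b * c) t.
Proof. by []. Qed.
Lemma endo_scale1 : left_id 1 endo_scale.
Proof. by []. Qed.
Lemma endo_scaleDr : right_distributive endo_scale +%R.
Proof. by move=> b t u; rewrite /endo_scale raddfD. Qed.
Lemma endo_scaleDl t : {morph endo_scale^~ t : b c / b + c}.
Proof. by []. Qed.

HB.instance Definition _ := GRing.Zmodule_isLmodule.Build endo endo_mod
  endo_scaleA endo_scale1 endo_scaleDr endo_scaleDl.

(* Hom_R(T, X) is a right End_R(T)-module by precomposition. *)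
Definition hom_scale (X : lmodType R) (b : endo^c) (f : homR T X) : homR T X :=
  (f \o (b : endo) : T -> X).

Lemma hom_scaleA X (b c : endo^c) (f : homR T X) :
  hom_scale b (hom_scale c f) = hom_scale (b * c) f.
Proof. by apply: homP. Qed.
Lemma hom_scale1 X : left_id 1 (@hom_scale X).
Proof. by move=> f; apply: homP. Qed.
Lemma hom_scaleDr X : right_distributive (@hom_scale X) +%R.
Proof. by move=> b f g; apply: homP. Qed.
Lemma hom_scaleDl X (f : homR T X) : {morph (@hom_scale X)^~ f : b c / b + c}.
Proof. by move=> b c; apply: homP => x /=; rewrite raddfD. Qed.

HB.instance Definition _ X := GRing.Zmodule_isLmodule.Build endo^c (homR T X)
  (@hom_scaleA X) (@hom_scale1 X) (@hom_scaleDr X) (@hom_scaleDl X).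

(* The functor Hom_R(T, -) on morphisms. *)
Definition hom_map_fun (X Y : lmodType R) (f : {linear X -> Y}) (h : homR T X) : homR T Y :=
  (f \o h : T -> Y).

Lemma hom_map_linear (X Y : lmodType R) (f : {linear X -> Y}) :
  linear (hom_map_fun f : homR T X -> homR T Y).
Proof. by move=> b g h; apply: homP => x /=; rewrite raddfD. Qed.

HB.instance Definition _ (X Y : lmodType R) (f : {linear X -> Y}) :=
  GRing.isLinear.Build endo^c (homR T X) (homR T Y) *:%R (hom_map_fun f)
    (hom_map_linear f).

Definition hom_map (X Y : lmodType R) (f : {linear X -> Y}) : {linear homR T X -> homR T Y} :=
  hom_map_fun f.

End Endo.

(* Tensor product of a right module Y and a left module Z: formal sums of     *)
(* pairs modulo the congruence generated by biadditivity and balancedness.    *)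
Section Tensor.
Variables (R : pzRingType) (Y : lmodType R^c) (Z : lmodType R).

Inductive tensor_rel : seq (Y * Z) -> seq (Y * Z) -> Prop :=
| TensorRefl s : tensor_rel s s
| TensorSym s t : tensor_rel s t -> tensor_rel t s
| TensorTrans s t u : tensor_rel s t -> tensor_rel t u -> tensor_rel s u
| TensorCat s t u : tensor_rel s t -> tensor_rel (s ++ u) (t ++ u)
| TensorCatC s t : tensor_rel (s ++ t) (t ++ s)
| TensorDl y y' z : tensor_rel [:: (y + y', z)] [:: (y, z); (y', z)]
| TensorDr y z z' : tensor_rel [:: (y, z + z')] [:: (y, z); (y, z')]
| Tensor0 z : tensor_rel [:: (0, z)] [::]
| TensorZ y (r : R) z : tensor_rel [:: ((r : R^c) *: y, z)] [:: (y, r *: z)].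

Definition tensor_relb s t := `[< tensor_rel s t >].

Lemma tensor_relb_refl : reflexive tensor_relb.
Proof. by move=> s; apply/asboolP; apply: TensorRefl. Qed.
Lemma tensor_relb_sym : symmetric tensor_relb.
Proof. by move=> s t; apply/asboolP/asboolP; apply: TensorSym. Qed.
Lemma tensor_relb_trans : transitive tensor_relb.
Proof.
by move=> t s u /asboolP st /asboolP tu; apply/asboolP; apply: TensorTrans tu.
Qed.

Canonical tensor_equiv :=
  EquivRel tensor_relb tensor_relb_refl tensor_relb_sym tensor_relb_trans.

Definition tensor := {eq_quot tensor_equiv}.
HB.instance Definition _ := Choice.on tensor.

Definition tensor_pi (s : seq (Y * Z)) : tensor := \pi s.

Lemma tensor_piP s t : tensor_pi s = tensor_pi t <-> tensor_rel s t.
Proof.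
have E := @eqquotP _ tensor_equiv tensor s t.
by split=> [/E/asboolP //|/asboolP st]; apply/E.
Qed.

Lemma tensor_repr x : tensor_pi (repr x) = x.
Proof. exact: reprK. Qed.

Definition tensor_neg (s : seq (Y * Z)) := [seq (- p.1, p.2) | p <- s].

Definition tensor_zero : tensor := tensor_pi [::].
Definition tensor_opp (x : tensor) := tensor_pi (tensor_neg (repr x)).
Definition tensor_add (x y : tensor) := tensor_pi (repr x ++ repr y).

Lemma tensor_rel_cat s s' t t' :
  tensor_rel s s' -> tensor_rel t t' -> tensor_rel (s ++ t) (s' ++ t').
Proof.
move=> ss' tt'; apply: TensorTrans (TensorCat t ss') _.
apply: TensorTrans (TensorCatC _ _) _.
by apply: TensorTrans (TensorCat _ tt') (TensorCatC _ _).
Qed.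

Lemma tensor_addE s t :
  tensor_add (tensor_pi s) (tensor_pi t) = tensor_pi (s ++ t).
Proof. by apply/tensor_piP/tensor_rel_cat; apply/tensor_piP/tensor_repr. Qed.

Lemma tensor_addA : associative tensor_add.
Proof.
move=> x y z; rewrite -(tensor_repr x) -(tensor_repr y) -(tensor_repr z).
by rewrite !tensor_addE catA.
Qed.
Lemma tensor_addC : commutative tensor_add.
Proof. by move=> x y; apply/tensor_piP/TensorCatC. Qed.
Lemma tensor_add0 : left_id tensor_zero tensor_add.
Proof. by move=> x; rewrite -(tensor_repr x) tensor_addE. Qed.
Lemma tensor_addN : left_inverse tensor_zero tensor_opp tensor_add.
Proof.
move=> x; rewrite /tensor_opp -{2}(tensor_repr x) tensor_addE.
apply/tensor_piP; elim: (repr x) => [|[y z] s IHs] /=.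
  exact: TensorRefl.
rewrite -cat1s -(cat1s (y, z)) (catA (tensor_neg s)).
have swap : tensor_rel ((tensor_neg s ++ [:: (y, z)]) ++ s)
                       ([:: (y, z)] ++ tensor_neg s ++ s).
  by rewrite catA; apply: TensorCat; apply: TensorCatC.
apply: TensorTrans (tensor_rel_cat (TensorRefl _) swap) _.
rewrite catA -[[::]]cat0s; apply: tensor_rel_cat IHs.
apply: TensorTrans (TensorSym (TensorDl _ _ _)) _.
by rewrite addNr; apply: Tensor0.
Qed.

HB.instance Definition _ := GRing.isZmodule.Build tensor
  tensor_addA tensor_addC tensor_add0 tensor_addN.

Definition tens (y : Y) (z : Z) : tensor := tensor_pi [:: (y, z)].

Lemma tensDl y y' z : tens (y + y') z = tens y z + tens y' z.
Proof.
by rewrite /GRing.add /= tensor_addE; apply/tensor_piP; apply: TensorDl.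
Qed.
Lemma tensDr y z z' : tens y (z + z') = tens y z + tens y z'.
Proof.
by rewrite [RHS]tensor_addE; apply/tensor_piP; apply: TensorDr.
Qed.
Lemma tensZ y (r : R) z : tens ((r : R^c) *: y) z = tens y (r *: z).
Proof. by apply/tensor_piP; apply: TensorZ. Qed.
Lemma tens0 z : tens 0 z = 0.
Proof. by apply/tensor_piP; apply: Tensor0. Qed.

Definition tensor_lift (G : zmodType) (b : Y -> Z -> G) (x : tensor) : G :=
  \sum_(p <- repr x) b p.1 p.2.

(* Universal property: a balanced biadditive map factors through [tens]. *)
Lemma tensor_liftE (G : zmodType) (b : Y -> Z -> G) :
    (forall y y' z, b (y + y') z = b y z + b y' z) ->
    (forall y z z', b y (z + z') = b y z + b y z') ->
    (forall y (r : R) z, b ((r : R^c) *: y) z = b y (r *: z)) ->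
  forall s, tensor_lift b (tensor_pi s) = \sum_(p <- s) b p.1 p.2.
Proof.
move=> bDl bDr bZ s; rewrite /tensor_lift.
have: tensor_rel (repr (tensor_pi s)) s by apply/tensor_piP/tensor_repr.
move: (repr _) => s'; elim=> {s s'} [//|s t _ -> //|s t u _ -> _ -> //|s t u _ IH|s t||||].
- by rewrite !big_cat /= IH.
- by rewrite !big_cat /= addrC.
- by move=> y y' z; rewrite !big_cons big_nil !addr0 /= bDl.
- by move=> y z z'; rewrite !big_cons big_nil !addr0 /= bDr.
- move=> z; rewrite big_seq1 big_nil /=.
  by apply: (addrI (b 0 z)); rewrite -bDl !addr0.
- by move=> y r z; rewrite !big_seq1 /= bZ.
Qed.

End Tensor.

(* f (x) Z *)
Definition tensor_map (R : pzRingType) (Y Y' : lmodType R^c) (Z : lmodType R)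
    (f : {linear Y -> Y'}) : tensor Y Z -> tensor Y' Z :=
  tensor_lift (fun y z => tens (f y) z).

Lemma tensor_mapE (R : pzRingType) (Y Y' : lmodType R^c) (Z : lmodType R)
    (f : {linear Y -> Y'}) s :
  tensor_map f (tensor_pi s) = \sum_(p <- s) tens (f p.1) (p.2 : Z).
Proof.
apply: tensor_liftE => [y y' z|y z z'|y r z].
- by rewrite raddfD tensDl.
- exact: tensDr.
- by rewrite linearZ tensZ.
Qed.

(* Tor_1(Y, Z) = 0, i.e. H_1(P (x) Z) = 0 for a projective resolution P of Y. *)
Definition Tor1_zero (R : pzRingType) (Y : lmodType R^c) (Z : lmodType R) :
    Prop :=
  exists P : proj_resolution Y,
    forall x : tensor (P 1%N) Z,
      tensor_map (res_diff P 0%N) x = 0 ->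
      exists w : tensor (P 2%N) Z, tensor_map (res_diff P 1%N) w = x.

(* The regular module is a direct sum of pairwise non-isomorphic              *)
(* indecomposable modules.                                                    *)
Definition basic (k : fieldType) (A : falgType k) : Prop :=
  exists (n : nat) (P : 'I_n -> lmodType A),
    [/\ forall i, indecomposable (P i),
        forall i j, mod_iso (P i) (P j) -> i = j
      & direct_sum_of (A^o : lmodType A) P].

Section Tilting.
Variables (R : pzRingType) (T : lmodType R).

Definition tilting : Prop :=
  [/\ fin_gen T, pd_le T 1, Ext1_zero T T
    & exists n,
        number_iso_classes (fun X => indecomposable X /\ summand X T) n /\
        number_iso_classes (@simple_mod R) n].

Definition torsion (X : lmodType R) : Prop := fin_gen X /\ Ext1_zero T X.

Definition torsion_free (X : lmodType R) : Prop :=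
  fin_gen X /\ forall f : homR T X, f = 0.

(* mod B is the category of finitely generated right modules over             *)
(* B = End(T), so that Hom(T, -) takes values in it.                          *)
Definition torsion_freeB (Y : lmodType (endo T)^c) : Prop :=
  fin_gen Y /\ Tor1_zero Y (endo_mod T).

Definition separating : Prop :=
  forall X : lmodType R, indecomposable X -> torsion X \/ torsion_free X.

End Tilting.

(* Main.v *)
Require Import Defs.
From HB Require Import structures.
From mathcomp Require Import all_boot all_order all_algebra falgebra boolp.
Set Implicit Arguments.
Unset Strict Implicit.
Unset Printing Implicit Defensive.
Import Order.TTheory GRing.Theory Num.Theory VectorInternalTheory.
Local Open Scope ring_scope.

(** Write F for the functor Hom_A(T, -), and Gen T for the class of modules
    generated by T.

    A morphism f in the n-th power of the radical is a sum of composites of n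
    radical morphisms between indecomposable modules.  As T is separating, an intermediate module either lies in F(T), and
    then F kills the composite, or lies in T(T).  On T(T) the functor F is fully
    faithful, so it sends radical morphisms between indecomposables to radical
    morphisms between indecomposables of Y(T).  Such a morphism is irreducible or
    lies in the square of the radical ([radical_irreducible]).  Hence F(f) is a sum
    of elements of the n-th power of the radical, each of which is a path of n
    irreducible morphisms or belongs to the (n+1)-st power ([hom_map_paths]).  If
    F(f) is not in the (n+1)-st power, some summand is not either; that summand is
    a path, and it is non-zero because 0 belongs to every power.

    Full faithfulness rests on the equality T(T) = Gen T ([torsion_gen]), where the
    condition on the number of summands of T enters.  If X lies in T(T), the
    quotient of X by the trace of T lies both in T(T) and in F(T), so it suffices
    to show that a module Y in both classes is zero.  For an indecomposable summand
    T_i of T the number dim Hom(T_i, X) - dim Ext^1(T_i, X) is additive in X, being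
    dim Hom(Q_i, X) - dim Hom(K_i, X) for a projective presentation
    0 -> K_i -> Q_i -> T_i -> 0.  Its values on the simple modules form a square
    matrix.  A non-zero Y in both classes gives a non-zero vector annihilated by
    this matrix on one side, hence one on the other side: rational numbers a_i, not
    all zero, with sum_i a_i dim Hom(T_i, X) = 0 for all X in T(T)
    ([relation_ex]).  Counting dimensions with X = T_j and X = a trace in T_j, the
    T_i with a_i > 0 generate those with a_i < 0, and conversely ([relation_gen]).
    Nakayama's lemma over the local rings End(T_i) shows that two disjoint families
    of pairwise non-isomorphic indecomposables cannot generate each other unless
    both are empty ([fam_mutual_gen]).

    Since kernels of suitable maps T^r -> X with X in T(T) are again in T(T)
    ([torsion_kernel]), every X in T(T) has a resolution by powers of T.  Its first
    two terms show that F is full ([hom_full]); applying F to the whole of it gives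
    a projective resolution of F(X) which the functor - (x) T turns back into the
    resolution of X, whence F(X) lies in Y(T) ([hom_torsion_freeB]). *)

(** * Modules: kernels, quotients, direct powers and traces *)

(** Packs a function with a proof of linearity, so that linear maps can be
    built inside proofs. *)
Definition mk_linear (R : pzRingType) (X Y : lmodType R) (f : X -> Y)
    (lf : linear f) : {linear X -> Y} :=
  HB.pack f (GRing.isLinear.Build R X Y *:%R f lf).

Definition surj (X Y : Type) (f : X -> Y) : Prop := forall y, exists x, f x = y.

Lemma inj_surj_bij (X Y : Type) (f : X -> Y) :
  injective f -> surj f -> bijective f.
Proof.
move=> fI fS; have [g gK] := choice fS.
by exists g => // x; apply: fI; rewrite gK.
Qed.

Lemma bij_surj (X Y : Type) (f : X -> Y) : bijective f -> surj f.
Proof. by case=> g _ gK y; exists (g y). Qed.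

Section Exact.
Variable R : pzRingType.
Implicit Types X Y Z W K L I P Q : lmodType R.

Lemma linear_inj X Y (f : {linear X -> Y}) :
  (forall x, f x = 0 -> x = 0) -> injective f.
Proof.
move=> f0 x y fxy; apply/eqP; rewrite -subr_eq0; apply/eqP/f0.
by rewrite linearB /= fxy subrr.
Qed.

Lemma linear_bij_inv X Y (f : {linear X -> Y}) : bijective f ->
  exists g : {linear Y -> X}, cancel f g /\ cancel g f.
Proof.
case=> g fK gK; exists (mk_linear (can2_linear fK gK)); split=> x /=.
  exact: fK.
exact: gK.
Qed.

Definition submodule X (V : X -> Prop) : Prop :=
  [/\ V 0, forall x y, V x -> V y -> V (x + y)
    & forall a x, V x -> V (a *: x)].

Section Sub.
Variables (X : lmodType R) (V : X -> Prop) (VP : submodule V).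
Definition sub_pred : {pred X} := fun x => `[< V x >].
Lemma sub_pred_closed : submod_closed sub_pred.
Proof.
case: VP => V0 VD VZ; split; first exact/asboolP.
by move=> a x y /asboolP Vx /asboolP Vy; apply/asboolP/VD => //; apply: VZ.
Qed.
HB.instance Definition _ := GRing.isSubmodClosed.Build R X sub_pred sub_pred_closed.
Record sub_sort := SubSort { sub_val : X; _ : sub_val \in sub_pred }.
HB.instance Definition _ := [isSub for sub_val].
HB.instance Definition _ := [Choice of sub_sort by <:].
HB.instance Definition _ := [SubChoice_isSubLmodule of sub_sort by <:].
Lemma submodule_ex_aux : exists (K : lmodType R) (j : {linear K -> X}),
  injective j /\ forall x, V x <-> exists y, j y = x.
Proof.
exists sub_sort, (val : {linear sub_sort -> X}); split; first exact: val_inj.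
move=> x; split=> [Vx|[[y Vy] <-]]; last exact/asboolP.
have Vx' : x \in sub_pred by apply/asboolP.
by exists (SubSort Vx').
Qed.
End Sub.

(** Submodules, kernels and quotients are only used through the exact
    sequences in which they occur, so that the underlying types never
    matter. *)
Lemma submodule_ex X (V : X -> Prop) : submodule V ->
  exists (K : lmodType R) (j : {linear K -> X}),
    injective j /\ forall x, V x <-> exists y, j y = x.
Proof. exact: submodule_ex_aux. Qed.

Lemma kernel_ex X Y (f : {linear X -> Y}) :
  exists (K : lmodType R) (j : {linear K -> X}),
    injective j /\ forall x, f x = 0 <-> exists y, j y = x.
Proof.
apply: submodule_ex; split=> [|x y fx fy|a x fx]; rewrite ?linear0 //.
  by rewrite linearD /= fx fy addr0.
by rewrite linearZ /= fx scaler0.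
Qed.

Lemma lift_along_inj X Y K (j : {linear K -> X}) (f : {linear Y -> X}) :
  injective j -> (forall y, exists z, j z = f y) ->
  exists g : {linear Y -> K}, forall y, j (g y) = f y.
Proof.
move=> jI /choice[g gP].
have lg : linear g by move=> a x y; apply: jI; rewrite linearP !gP linearP.
by exists (mk_linear lg).
Qed.

(** Values are chosen on preimages; the inclusion of kernels makes the
    choice irrelevant. *)
Lemma factor_through_surj X Y Z (q : {linear X -> Z}) (f : {linear X -> Y}) :
  surj q -> (forall x, q x = 0 -> f x = 0) ->
  exists g : {linear Z -> Y}, forall x, g (q x) = f x.
Proof.
move=> /choice[s sK] qf.
have E x : f (s (q x)) = f x.
  apply/eqP; rewrite -subr_eq0 -linearB; apply/eqP/qf.
  by rewrite linearB /= sK subrr.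
have lg : linear (f \o s).
  move=> a x y /=; have <- : f (a *: s x + s y) = a *: f (s x) + f (s y).
    exact: linearP.
  by rewrite -[RHS]E linearP /= !sK.
by exists (mk_linear lg) => x /=.
Qed.

Section Quot.
Variables (X : lmodType R) (V : X -> Prop) (VP : submodule V).
Let S := sub_pred V.
Let SP := sub_pred_closed VP.
HB.instance Definition _ := GRing.isSubmodClosed.Build R X S SP.
Let S' : zmodClosed X := S.
Definition quo : Type := {ideal_quot S'}%type.
HB.instance Definition _ := GRing.Zmodule.on quo.
Definition quo_pi (x : X) : quo := (\pi_{ideal_quot S'} x)%qT.
Lemma quo_piP x y : quo_pi x = quo_pi y <-> V (x - y).
Proof.
rewrite /quo_pi; have E : ((\pi_{ideal_quot S'} x == \pi_{ideal_quot S'} y) = (x - y \in S'))%qT.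
  by rewrite Quotient.idealrBE.
by split=> [/eqP|Vxy]; [rewrite E => /asboolP|apply/eqP; rewrite E; apply/asboolP].
Qed.
Lemma quo_pi_surj : surj quo_pi.
Proof. by move=> x; exists (repr x); rewrite /quo_pi reprK. Qed.
Lemma quo_piD x y : quo_pi (x + y) = quo_pi x + quo_pi y.
Proof. exact: (raddfD (\pi_{ideal_quot S'})%qT). Qed.
Definition quo_scale (a : R) (x : quo) : quo := quo_pi (a *: repr x).
Lemma quo_scaleE a x : quo_scale a (quo_pi x) = quo_pi (a *: x).
Proof.
apply/quo_piP; rewrite -scalerBr; case: VP => _ _; apply.
by apply/quo_piP; rewrite /quo_pi reprK.
Qed.
Lemma quo_scaleA a b x : quo_scale a (quo_scale b x) = quo_scale (a * b) x.
Proof. by have [y <-] := quo_pi_surj x; rewrite !quo_scaleE scalerA. Qed.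
Lemma quo_scale1 : left_id 1 quo_scale.
Proof. by move=> x; have [y <-] := quo_pi_surj x; rewrite quo_scaleE scale1r. Qed.
Lemma quo_scaleDr : right_distributive quo_scale +%R.
Proof.
move=> a x y; have [x' <-] := quo_pi_surj x; have [y' <-] := quo_pi_surj y.
by rewrite -quo_piD !quo_scaleE scalerDr quo_piD.
Qed.
Lemma quo_scaleDl x : {morph quo_scale^~ x : a b / a + b}.
Proof.
by move=> a b; have [y <-] := quo_pi_surj x; rewrite !quo_scaleE scalerDl quo_piD.
Qed.
HB.instance Definition _ := GRing.Zmodule_isLmodule.Build R quo
  quo_scaleA quo_scale1 quo_scaleDr quo_scaleDl.
Lemma quo_pi_linear : linear quo_pi.
Proof. by move=> a x y; rewrite quo_piD -quo_scaleE. Qed.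
Lemma quotient_ex_aux : exists (Z : lmodType R) (q : {linear X -> Z}),
  surj q /\ forall x, q x = 0 <-> V x.
Proof.
exists quo, (mk_linear quo_pi_linear); split; first exact: quo_pi_surj.
move=> x /=; have -> : (0 : quo) = quo_pi 0.
  by rewrite -[RHS](addrK (quo_pi 0)) -quo_piD addr0 subrr.
by rewrite quo_piP subr0.
Qed.
End Quot.

Lemma quotient_ex X (V : X -> Prop) : submodule V ->
  exists (Z : lmodType R) (q : {linear X -> Z}),
    surj q /\ forall x, q x = 0 <-> V x.
Proof. exact: quotient_ex_aux. Qed.

Lemma linear_ext X Y (f g : {linear X -> Y}) : f =1 g -> f = g.
Proof. exact: (@homP R X Y f g). Qed.

Lemma mod_iso_sym X Y : mod_iso X Y -> mod_iso Y X.
Proof.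
by case=> f /linear_bij_inv[g [fK gK]]; exists g, f.
Qed.

Lemma fin_gen_surj X Y (f : {linear X -> Y}) : surj f -> fin_gen X -> fin_gen Y.
Proof.
move=> fS [n [v vP]]; exists n, (f \o v) => y; have [x <-] := fS y.
have [a ->] := vP x; exists a; rewrite linear_sum; apply: eq_bigr => i _.
by rewrite linearZ.
Qed.

(** The usual decomposition: the image of an idempotent is the kernel of its
    complement. *)
Lemma idem_split X (e : {linear X -> X}) : (forall x, e (e x) = e x) ->
  exists Y Z (i : {linear Y -> X}) (j : {linear Z -> X}),
  [/\ mod_iso X (Y * Z)%type, injective i, injective j,
      forall x, e x = x <-> exists y, i y = x & forall x, e x = 0 <-> exists z, j z = x].
Proof.
move=> ee; have [Z [j [jI jP]]] := kernel_ex e.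
have l1e : linear (fun x => x - e x).
  by move=> a x y; rewrite linearP /= scalerBr opprD addrACA.
have [Y [i [iI iP]]] := kernel_ex (mk_linear l1e).
have iP' x : e x = x <-> exists y, i y = x.
  rewrite -iP /=; split=> [->|/eqP]; first exact: subrr.
  by rewrite subr_eq0 => /eqP.
have [p pP] : exists p : {linear X -> Y}, forall x, i (p x) = e x.
  by apply: lift_along_inj => // x; apply/iP'; rewrite ee.
have [q qP] : exists q : {linear X -> Z}, forall x, j (q x) = x - e x.
  by apply: (@lift_along_inj _ _ _ j (mk_linear l1e)) => // x; apply/jP => /=; rewrite linearB /= ee subrr.
exists Y, Z, i, j; split=> //; apply: mod_iso_sym.
have lf : linear (fun u : Y * Z => i u.1 + j u.2).
  by move=> a u v /=; rewrite !linearP /= scalerDr addrACA.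
exists (mk_linear lf); exists (fun x => (p x, q x)) => [[y z]|x] /=; last first.
  by rewrite pP qP addrC subrK.
have ey : e (i y) = i y by apply/iP'; exists y.
have ez : e (j z) = 0 by apply/jP; exists z.
congr pair; [apply: iI|apply: jI].
  by rewrite pP linearD /= ey ez addr0.
by rewrite qP linearD /= ey ez addr0 addrAC subrr add0r.
Qed.

Lemma indec_idem X (e : {linear X -> X}) : indecomposable X ->
  (forall x, e (e x) = e x) -> (forall x, e x = x) \/ (forall x, e x = 0).
Proof.
case=> _ _ X2 ee; have [Y [Z [i [j [iso iI jI iP jP]]]]] := idem_split ee.
case: (X2 _ _ iso) => U0; [right|left] => x.
  by have /iP[y <-] := ee x; rewrite (U0 y) linear0.
have /jP[z] : e (x - e x) = 0 by rewrite linearB /= ee subrr.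
by rewrite (U0 z) linear0 => /esym/eqP; rewrite subr_eq0 => /eqP.
Qed.

(** A decomposition of X yields the projection to its first factor; this
    form transports along fully faithful functors. *)
Lemma indec_of_idem X : fin_gen X -> ~ zero_mod X ->
  (forall e : {linear X -> X}, (forall x, e (e x) = e x) ->
     (forall x, e x = x) \/ (forall x, e x = 0)) -> indecomposable X.
Proof.
move=> fX X0 eX; split=> // Y Z [f fB].
have [g [fK gK]] := linear_bij_inv fB.
have lp : linear (fun u : Y * Z => (u.1, 0) : Y * Z).
  by move=> a [y z] [y' z'] /=; congr pair; rewrite /= scaler0 addr0.
have [|e1|e0] := eX (g \o mk_linear lp \o f).
- by move=> x /=; rewrite gK.
- right=> z; have := e1 (g (0, z)); rewrite /= gK /= => /(can_inj gK).
  by case=> <-.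
- left=> y; have := e0 (g (y, 0)); rewrite /= gK /= => /(congr1 f).
  by rewrite gK linear0 => -[].
Qed.

(** The idempotent [i \o p] is 1 or 0, and 0 is excluded because L is
    non-zero. *)
Lemma indec_retract X L (i : {linear L -> X}) (p : {linear X -> L}) :
  indecomposable X -> ~ zero_mod L -> cancel i p -> cancel p i.
Proof.
move=> Xi L0 ip; have [|//|e0] := @indec_idem X (i \o p) Xi.
  by move=> x /=; rewrite ip.
by case: L0 => y; have := e0 (i y); rewrite /= ip => iy0; rewrite -(ip y) iy0 linear0.
Qed.

Lemma indec_nz X : indecomposable X -> ~ zero_mod X.
Proof. by case. Qed.
Lemma indec_fg X : indecomposable X -> fin_gen X.
Proof. by case. Qed.

Definition dpow (T : lmodType R) (r : nat) : lmodType R := {ffun 'I_r -> T}.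

Section Pow.
Variables (T : lmodType R) (r : nat).
Lemma dpow_in_linear (i : 'I_r) :
  linear (fun t : T => [ffun j => if j == i then t else 0] : dpow T r).
Proof.
move=> a t u; apply/ffunP => j; rewrite !ffunE.
by case: (j == i); rewrite // scaler0 addr0.
Qed.
Definition dpow_in i : {linear T -> dpow T r} := mk_linear (dpow_in_linear i).
Lemma dpow_pr_linear (i : 'I_r) : linear (fun t : dpow T r => t i).
Proof. by move=> a t u; rewrite !ffunE. Qed.
Definition dpow_pr i : {linear dpow T r -> T} := mk_linear (dpow_pr_linear i).
Lemma dpow_sum (t : dpow T r) : t = \sum_i dpow_in i (t i).
Proof.
apply/ffunP=> j; rewrite sum_ffunE (bigD1 j) //= ffunE eqxx big1 ?addr0 //.
by move=> i ij; rewrite ffunE eq_sym (negPf ij).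
Qed.
Variable X : lmodType R.
Lemma dpow_copair_linear (u : 'I_r -> {linear T -> X}) :
  linear (fun t : dpow T r => \sum_i u i (t i)).
Proof.
move=> a t v; rewrite scaler_sumr -big_split /=; apply: eq_bigr => i _.
by rewrite !ffunE linearP.
Qed.
Definition dpow_copair u : {linear dpow T r -> X} := mk_linear (dpow_copair_linear u).
Lemma dpow_pair_linear (v : 'I_r -> {linear X -> T}) :
  linear (fun x => [ffun i => v i x] : dpow T r).
Proof. by move=> a x y; apply/ffunP => i; rewrite !ffunE linearP. Qed.
Definition dpow_pair v : {linear X -> dpow T r} := mk_linear (dpow_pair_linear v).
End Pow.

Lemma fin_gen_family (I : finType) X (v : I -> X) :
  (forall x, exists a : I -> R, x = \sum_i a i *: v i) -> fin_gen X.
Proof.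
move=> vP; exists #|I|, (fun i => v (enum_val i)) => x; have [a ->] := vP x.
exists (fun i => a (enum_val i)); rewrite [RHS](reindex enum_rank) /=.
  by apply: eq_bigr => i _; rewrite enum_rankK.
by exists enum_val => i _; rewrite ?enum_rankK ?enum_valK.
Qed.

Lemma fin_gen_dpow X r : fin_gen X -> fin_gen (dpow X r).
Proof.
case=> n [v vP]; apply: (@fin_gen_family ('I_r * 'I_n)%type _ (fun p => dpow_in X p.1 (v p.2))) => t.
have [a aP] := choice (fun i => vP (t i)).
exists (fun p => a p.1 p.2).
rewrite -(pair_bigA _ (fun i l => a i l *: dpow_in X i (v l))) /= [LHS]dpow_sum.
apply: eq_bigr => i _; rewrite {1}aP linear_sum; apply: eq_bigr => l _.
by rewrite linearZ.
Qed.

Lemma free_projective r : projective (dpow (R^o) r).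
Proof.
move=> X Y g f gS.
have [x xP] := choice (fun i => gS (f (dpow_in (R^o : lmodType R) i (1 : R^o)))).
have lx i : linear (fun a : R^o => (a : R) *: x i : X).
  by move=> a b c; rewrite scalerDl scalerA.
exists (dpow_copair (fun i => mk_linear (lx i))) => t /=.
rewrite {1}[t]dpow_sum !linear_sum; apply: eq_bigr => i _ /=.
rewrite linearZ /= xP -linearZ /=; congr (f _); apply/ffunP => j; rewrite !ffunE.
by case: (j == i); rewrite ?scaler0 // /GRing.scale /= mulr1.
Qed.

Lemma free_cover X : fin_gen X -> exists r (q : {linear dpow (R^o) r -> X}), surj q.
Proof.
case=> r [x xP].
have lx i : linear (fun a : R^o => (a : R) *: x i : X).
  by move=> a b c; rewrite scalerDl scalerA.
exists r, (dpow_copair (fun i => mk_linear (lx i))) => y.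
have [a ->] := xP y; exists [ffun i => a i] => /=.
by apply: eq_bigr => i _; rewrite ffunE.
Qed.

Lemma free_fin_gen r : fin_gen (dpow (R^o) r).
Proof.
exists r, (fun i => dpow_in (R^o : lmodType R) i (1 : R^o)) => t; exists t.
rewrite {1}[t]dpow_sum; apply: eq_bigr => i _.
rewrite -linearZ /=; congr (dpow_in _ _ _).
by rewrite /GRing.scale /= mulr1.
Qed.

(** The trace is encoded as the smallest additive subgroup containing all
    images of maps from modules in C; it is a submodule because each of
    these images is one. *)
Definition trace (C : lmodType R -> Prop) X (x : X) : Prop :=
  forall V : X -> Prop, V 0 -> (forall x y, V x -> V y -> V (x + y)) ->
   (forall Z (u : {linear Z -> X}) t, C Z -> V (u t)) -> V x.

Definition gen_by (C : lmodType R -> Prop) X : Prop := forall x : X, trace C x.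

Definition only (T X : lmodType R) : Prop := X = T.

Section Trace.
Variable C : lmodType R -> Prop.
Lemma trace_im X Z (u : {linear Z -> X}) t : C Z -> trace C (u t).
Proof. by move=> CZ V _ _; apply. Qed.
Lemma trace0 X : trace C (0 : X).
Proof. by move=> V. Qed.
Lemma traceD X (x y : X) : trace C x -> trace C y -> trace C (x + y).
Proof. by move=> tx ty V V0 VD Vu; apply: (VD); [exact: (tx V V0 VD Vu)|exact: (ty V V0 VD Vu)]. Qed.
Lemma trace_map X Y (f : {linear X -> Y}) x : trace C x -> trace C (f x).
Proof.
move=> tx V V0 VD Vu; apply: (tx (fun x => V (f x))).
- by rewrite linear0.
- by move=> y z; rewrite linearD; apply: VD.
- by move=> Z u t CZ; apply: (Vu Z (f \o u)).
Qed.
Lemma traceZ X a (x : X) : trace C x -> trace C (a *: x).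
Proof.
move=> tx V V0 VD Vu; apply: (tx (fun x => V (a *: x))).
- by rewrite scaler0.
- by move=> y z; rewrite scalerDr; apply: VD.
- by move=> Z u t CZ; rewrite -linearZ; apply: Vu.
Qed.
Lemma trace_submodule X : submodule (@trace C X).
Proof.
by split; [exact: trace0|move=> *; exact: traceD|move=> *; exact: traceZ].
Qed.
(** The trace is itself generated by C, since the maps from modules in C to
    X corestrict to it. *)
Lemma trace_ex X : exists (I : lmodType R) (j : {linear I -> X}),
  [/\ injective j, forall x, trace C x <-> exists y, j y = x & gen_by C I].
Proof.
have [I [j [jI jP]]] := submodule_ex (trace_submodule X).
exists I, j; split=> // y.
suff: forall x, trace C x -> trace C x /\ forall y, j y = x -> trace C y.
  have /jP jy : exists z, j z = j y by exists y.
  by case/(_ _ jy) => _; apply.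
move=> x tx; split=> // {}y yx; rewrite -{}yx in tx.
suff: exists2 z, j z = j y & trace C z by case=> z /jI ->.
apply: (tx (fun x => exists2 z, j z = x & trace C z)).
- by exists 0; [rewrite linear0|apply: trace0].
- move=> _ _ [z <- tz] [z' <- tz']; exists (z + z'); first by rewrite linearD.
  exact: traceD.
- move=> Z u t CZ; have [v vP] : exists v : {linear Z -> I}, forall t, j (v t) = u t.
    by apply: lift_along_inj => // {}t; apply/jP; apply: trace_im.
  by exists (v t); [rewrite vP|apply: trace_im].
Qed.
End Trace.

Lemma trace_trans (C D : lmodType R -> Prop) X (x : X) :
  (forall Z, C Z -> gen_by D Z) -> trace C x -> trace D x.
Proof.
move=> CD tx; apply: (tx (@trace D X)) => [|y z|Z u t CZ]; first exact: trace0.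
  exact: traceD.
exact: (trace_map u (CD _ CZ t)).
Qed.
End Exact.

(** * Dimensions over the ground field *)

Section Dim.
Variable k : fieldType.
Implicit Types U V W : lmodType k.

Definition has_dim V (d : nat) := exists f : {linear 'rV[k]_d -> V}, bijective f.
(** A bound on the size of linearly independent families; unlike the
    existence of a basis it passes to subspaces and quotients at once. *)
Definition dim_le V (d : nat) :=
  forall e (f : {linear 'rV[k]_e -> V}), injective f -> (e <= d)%N.

Lemma dim_le_row d : dim_le ('rV[k]_d : lmodType k) d.
Proof.
move=> e f fI.
have : kermx (lin1_mx f) == 0.
  apply/eqP/row_matrixP => i; rewrite row0; apply: fI.
  rewrite linear0 -mul_rV_lin1; apply/eqP.
  by rewrite -row_mul mulmx_ker row0.
by rewrite kermx_eq0 => /eqP <-; apply: rank_leq_col.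
Qed.

Lemma has_dim_le V d : has_dim V d -> dim_le V d.
Proof.
case=> f /linear_bij_inv[g [fK gK]] e h hI.
by apply: (@dim_le_row d e (g \o h)) => x y /= /(can_inj gK)/hI.
Qed.

Lemma has_dim_uniq V d e : has_dim V d -> has_dim V e -> d = e.
Proof.
move=> Vd Ve; apply/eqP; rewrite eqn_leq.
case: (Vd) (Ve) => f /bij_inj fI [g /bij_inj gI].
by rewrite (has_dim_le Ve fI) (has_dim_le Vd gI).
Qed.

Lemma row_split_linear V e (f : {linear 'rV[k]_e -> V}) (v : V) :
  linear (fun u : 'rV[k]_(e + 1) => f (lsubmx u) + rsubmx u 0 0 *: v).
Proof.
by move=> a x y; rewrite !linearP /= !mxE scalerDl scalerDr scalerA addrACA.
Qed.

(** A vector outside the image of f would extend f to an injection from a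
    space of dimension d + 1. *)
Lemma dim_le_max V d (f : {linear 'rV[k]_d -> V}) :
  injective f -> dim_le V d -> surj f.
Proof.
move=> fI Vd v; apply: contrapT => nv.
have /Vd : injective (mk_linear (row_split_linear f v)).
  apply: linear_inj => u /=.
  have [u0|u0] := eqVneq (rsubmx u 0 0) 0; last first.
    move=> E; case: nv; exists (- (rsubmx u 0 0)^-1 *: lsubmx u).
    rewrite linearZ /= -[f _](addrK (rsubmx u 0 0 *: v)) E sub0r scalerN scaleNr opprK.
    by rewrite scalerA mulVf // scale1r.
  rewrite u0 scale0r addr0 -(linear0 f) => /fI l0.
  rewrite -[u]hsubmxK l0; have -> : rsubmx u = 0; last exact: row_mx0.
  by apply/matrixP => i j; rewrite !ord1 u0 mxE.
by rewrite addn1 ltnn.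
Qed.

Lemma dim_le_has V d : dim_le V d -> exists2 e, (e <= d)%N & has_dim V e.
Proof.
elim: d => [|d IHd] Vd.
  have l0 : linear (fun _ : 'rV[k]_0 => 0 : V) by move=> a x y /=; rewrite scaler0 addr0.
  have i0 : injective (mk_linear l0) by move=> x y _; rewrite [x]thinmx0 [y]thinmx0.
  by exists 0%N => //; exists (mk_linear l0); apply: (inj_surj_bij i0); apply: dim_le_max.
have [[f fI]|nf] := pselect (exists f : {linear 'rV[k]_d.+1 -> V}, injective f).
  by exists d.+1 => //; exists f; apply: (inj_surj_bij fI); apply: dim_le_max.
have [e f fI|e ed Ve] := IHd; last by exists e => //; apply: leqW.
have := Vd e f fI; rewrite leq_eqVlt ltnS => /orP[/eqP ee|//].
by case: nf; subst e; exists f.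
Qed.

Lemma dim_le_inj U V d (f : {linear U -> V}) : injective f -> dim_le V d -> dim_le U d.
Proof. by move=> fI Vd e g gI; apply: (Vd e (f \o g)) => x y /= /fI /gI. Qed.

Lemma lift_row V W d (q : {linear V -> W}) (f : {linear 'rV[k]_d -> W}) :
  surj q -> exists g : {linear 'rV[k]_d -> V}, forall x, q (g x) = f x.
Proof.
move=> /choice[s sK].
have lg : linear (fun u : 'rV[k]_d => \sum_i u 0 i *: s (f (delta_mx 0 i))).
  move=> a x y; rewrite scaler_sumr -big_split /=; apply: eq_bigr => i _.
  by rewrite !mxE scalerDl scalerA.
exists (mk_linear lg) => x /=; rewrite linear_sum /= {2}[x]row_sum_delta linear_sum.
by apply: eq_bigr => i _; rewrite !linearZ /= sK.
Qed.

Lemma dim_le_surj V W d (q : {linear V -> W}) : surj q -> dim_le V d -> dim_le W d.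
Proof.
move=> qS Vd e f fI; have [g gP] := lift_row f qS.
by apply: (Vd e g) => x y gxy; apply: fI; rewrite -!gP gxy.
Qed.

Lemma has_dim_exact U V W d e (i : {linear U -> V}) (q : {linear V -> W}) :
  injective i -> surj q -> (forall v, q v = 0 <-> exists u, i u = v) ->
  has_dim U d -> has_dim W e -> has_dim V (d + e).
Proof.
move=> iI qS iq [f fB] [g gB]; have [h hP] := lift_row g qS.
have lF : linear (fun u : 'rV[k]_(d + e) => i (f (lsubmx u)) + h (rsubmx u)).
  by move=> a x y; rewrite !linearP /= scalerDr addrACA.
exists (mk_linear lF); apply: inj_surj_bij.
  apply: linear_inj => u /= E.
  have r0 : rsubmx u = 0.
    apply: (bij_inj gB); rewrite -hP linear0 -[RHS](linear0 q) -E linearD /=.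
    by rewrite (_ : q (i _) = 0) ?add0r //; apply/iq; eexists.
  move: E; rewrite r0 linear0 addr0 -(linear0 i) => /iI; rewrite -(linear0 f) => /(bij_inj fB) l0.
  by rewrite -[u]hsubmxK l0 r0 row_mx0.
move=> v; have [b gb] := bij_surj gB (q v).
have /iq[u iu] : q (v - h b) = 0 by rewrite linearB /= hP gb subrr.
have [a fa] := bij_surj fB u.
by exists (row_mx a b) => /=; rewrite row_mxKl row_mxKr fa iu subrK.
Qed.

Lemma has_dim_inj_surj U V d (f : {linear U -> V}) :
  injective f -> has_dim U d -> has_dim V d -> surj f.
Proof.
move=> fI [g gB] Vd v.
have [|x <-] := @dim_le_max V d (f \o g) _ (has_dim_le Vd) v.
  by move=> x y /= /fI /(bij_inj gB).
by exists (g x).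
Qed.

Lemma has_dim_iso U V d (f : {linear U -> V}) : bijective f -> has_dim U d -> has_dim V d.
Proof. by move=> fB [g gB]; exists (f \o g); apply: (bij_comp fB gB). Qed.

Definition dimk V : nat :=
  if pselect (exists d, has_dim V d) is left p then sval (cid p) else 0%N.
Definition findim V := exists d, dim_le V d.

Lemma dimkP V : findim V -> has_dim V (dimk V).
Proof.
case=> d /dim_le_has[e _ Ve]; rewrite /dimk; case: pselect => [p|[]]; last by exists e.
by case: (cid p).
Qed.

Lemma dimkE V d : has_dim V d -> dimk V = d.
Proof.
by move=> Vd; apply: (@has_dim_uniq V) => //; apply: dimkP; exists d; apply: has_dim_le.
Qed.

Lemma dimk_exact U V W (i : {linear U -> V}) (q : {linear V -> W}) :
  injective i -> surj q -> (forall v, q v = 0 <-> exists u, i u = v) ->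
  findim V -> dimk V = (dimk U + dimk W)%N.
Proof.
move=> iI qS iq [d Vd]; apply: dimkE; apply: (has_dim_exact iI qS iq); apply: dimkP; exists d.
  exact: dim_le_inj iI Vd.
exact: dim_le_surj qS Vd.
Qed.

Lemma dimk_iso U V (f : {linear U -> V}) : bijective f -> findim U -> dimk U = dimk V.
Proof. by move=> fB fU; apply/esym/dimkE/(has_dim_iso fB)/dimkP. Qed.

Lemma findim_inj U V (f : {linear U -> V}) : injective f -> findim V -> findim U.
Proof. by move=> fI [d Vd]; exists d; apply: dim_le_inj fI Vd. Qed.
Lemma findim_surj U V (f : {linear U -> V}) : surj f -> findim U -> findim V.
Proof. by move=> fI [d Vd]; exists d; apply: dim_le_surj fI Vd. Qed.

Lemma dimk_inj U V (f : {linear U -> V}) : injective f -> findim V -> (dimk U <= dimk V)%N.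
Proof.
move=> fI fV; have [g gB] := dimkP (findim_inj fI fV).
apply: (has_dim_le (dimkP fV) (f := f \o g)) => x y /= /fI /(bij_inj gB) //.
Qed.

Lemma dimk_inj_surj U V (f : {linear U -> V}) : injective f -> findim V ->
  (dimk V <= dimk U)%N -> surj f.
Proof.
move=> fI fV VU; have E : dimk U = dimk V by apply/eqP; rewrite eqn_leq VU (dimk_inj fI).
apply: (has_dim_inj_surj fI (dimkP (findim_inj fI fV))); rewrite E; exact: dimkP.
Qed.

Lemma findim_mx m n : findim ('M[k]_(m, n) : lmodType k).
Proof.
exists (m * n)%N; apply: has_dim_le; exists (vec_mx : {linear 'rV[k]_(m * n) -> 'M[k]_(m, n)}).
by exists mxvec; [exact: vec_mxK|exact: mxvecK].
Qed.

Lemma findim_basis V : findim V ->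
  exists n (v : 'I_n -> V), forall x, exists c : 'I_n -> k, x = \sum_i c i *: v i.
Proof.
move=> /dimkP[f fB]; exists (dimk V), (fun i => f (delta_mx 0 i)) => x.
have [u <-] := bij_surj fB x; exists (u 0); rewrite {1}[u]row_sum_delta linear_sum.
by apply: eq_bigr => i _; rewrite linearZ.
Qed.
End Dim.

Section AlgMod.
Variables (k : fieldType) (A : falgType k).
Implicit Types X Y Z P : lmodType A.

(** An A-module seen as a k-vector space, through the scalars [c%:A]. *)
Definition resk X : Type := X.
Section Resk.
Variable X : lmodType A.
HB.instance Definition _ := GRing.Zmodule.on (resk X).
Definition resk_scale (c : k) (x : resk X) : resk X := c%:A *: (x : X).
Lemma resk_scaleA a b x : resk_scale a (resk_scale b x) = resk_scale (a * b) x.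
Proof. by rewrite /resk_scale scalerA -scalerAl mul1r scalerA. Qed.
Lemma resk_scale1 : left_id 1 resk_scale.
Proof. by move=> x; rewrite /resk_scale !scale1r. Qed.
Lemma resk_scaleDr : right_distributive resk_scale +%R.
Proof. by move=> a x y; rewrite /resk_scale scalerDr. Qed.
Lemma resk_scaleDl x : {morph resk_scale^~ x : a b / a + b}.
Proof. by move=> a b; rewrite /resk_scale !scalerDl. Qed.
HB.instance Definition _ := GRing.Zmodule_isLmodule.Build k (resk X)
  resk_scaleA resk_scale1 resk_scaleDr resk_scaleDl.
End Resk.

Lemma resk_map_linear X Y (f : {linear X -> Y}) : linear (f : resk X -> resk Y).
Proof. by move=> c x y; rewrite linearD; congr (_ + _); rewrite -[RHS]linearZ. Qed.
Definition resk_map X Y (f : {linear X -> Y}) : {linear resk X -> resk Y} :=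
  mk_linear (resk_map_linear f).

(** Hom_A(X, Y) as a k-vector space; an alias, because [homR X Y] already
    carries the action of End(X). *)
Definition khom X Y : Type := homR X Y.
Section Khom.
Variables X Y : lmodType A.
HB.instance Definition _ := GRing.Zmodule.on (khom X Y).
Lemma scalarA_central (c : k) (a : A) : c%:A * a = a * c%:A.
Proof. by rewrite -scalerAl -scalerAr mul1r mulr1. Qed.
Lemma khom_scale_linear (c : k) (f : khom X Y) : linear (fun x => c%:A *: f x).
Proof. by move=> a x y; rewrite linearP scalerDr !scalerA scalarA_central. Qed.
Definition khom_scale c (f : khom X Y) : khom X Y := mk_linear (khom_scale_linear c f).
Lemma khom_scaleA a b f : khom_scale a (khom_scale b f) = khom_scale (a * b) f.
Proof. by apply: homP => x /=; rewrite scalerA -scalerAl mul1r scalerA. Qed.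
Lemma khom_scale1 : left_id 1 khom_scale.
Proof. by move=> f; apply: homP => x /=; rewrite !scale1r. Qed.
Lemma khom_scaleDr : right_distributive khom_scale +%R.
Proof. by move=> a f g; apply: homP => x /=; rewrite scalerDr. Qed.
Lemma khom_scaleDl f : {morph khom_scale^~ f : a b / a + b}.
Proof. by move=> a b; apply: homP => x /=; rewrite !scalerDl. Qed.
HB.instance Definition _ := GRing.Zmodule_isLmodule.Build k (khom X Y)
  khom_scaleA khom_scale1 khom_scaleDr khom_scaleDl.
End Khom.

Lemma khom_sumE X Y (I : Type) (r : seq I) (F : I -> khom X Y) x :
  (\sum_(i <- r) F i : khom X Y) x = \sum_(i <- r) F i x.
Proof. by elim: r => [|i r IH]; rewrite ?big_nil // !big_cons /= -IH. Qed.

Lemma khom_post_linear X Y Z (f : {linear Y -> Z}) :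
  linear (fun g : khom X Y => (f \o g : {linear X -> Z}) : khom X Z).
Proof.
move=> c g h; apply: homP => x /=; rewrite linearD /=; congr (_ + _).
by rewrite linearZ.
Qed.
Definition khom_post X Y Z (f : {linear Y -> Z}) : {linear khom X Y -> khom X Z} :=
  mk_linear (@khom_post_linear X Y Z f).
Lemma khom_pre_linear X Y Z (f : {linear X -> Y}) :
  linear (fun g : khom Y Z => (g \o f : {linear X -> Z}) : khom X Z).
Proof. by move=> c g h; apply: homP. Qed.
Definition khom_pre X Y Z (f : {linear X -> Y}) : {linear khom Y Z -> khom X Z} :=
  mk_linear (@khom_pre_linear X Y Z f).

(** X is a quotient of a power of A, hence of a space of matrices over k. *)
Lemma fin_gen_findim X : fin_gen X -> findim (resk X).
Proof.
case=> n [v vP].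
have lF : linear (fun M : 'M[k]_(n, dim A) =>
    (\sum_i (r2v (row i M) : A) *: v i : X) : resk X).
  move=> c M N; rewrite scaler_sumr -big_split /=; apply: eq_bigr => i _.
  rewrite !linearP /= scalerDl; congr (_ + _).
  by rewrite [RHS]scalerA -scalerAl mul1r.
apply: (@findim_surj _ _ _ (mk_linear lF)); last exact: findim_mx.
move=> x; have [a aE] := vP x; exists (\matrix_(i, j) v2r (a i) 0 j) => /=.
rewrite aE; apply: eq_bigr => i _.
rewrite (_ : row i _ = v2r (a i)) ?v2rK //.
by apply/rowP => j; rewrite !mxE.
Qed.

Lemma findim_fin_gen X : findim (resk X) -> fin_gen X.
Proof.
move=> /findim_basis[n [v vP]]; exists n, v => x.
by have [c cE] := vP x; exists (fun i => (c i)%:A).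
Qed.

Lemma fin_gen_inj X Y (f : {linear X -> Y}) : injective f -> fin_gen Y -> fin_gen X.
Proof.
move=> fI /fin_gen_findim fY; apply: findim_fin_gen.
exact: (@findim_inj _ _ _ (resk_map f)).
Qed.

(** A linear map is determined by its values on generators of X, which form
    a matrix once a basis of Y is fixed. *)
Lemma khom_findim X Y : fin_gen X -> fin_gen Y -> findim (khom X Y).
Proof.
case=> n [v vP] /fin_gen_findim /dimkP[g gB].
have [h [gK hK]] := linear_bij_inv gB.
have lF : linear (fun f : khom X Y => \matrix_i (h (f (v i)))).
  move=> c f1 f2; apply/row_matrixP => i; rewrite linearP /= !rowK.
  by rewrite -linearP.
apply: (@findim_inj _ _ _ (mk_linear lF)); last exact: findim_mx.
move=> f1 f2 /= E; apply: homP => x; have [a ->] := vP x.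
rewrite !linear_sum; apply: eq_bigr => i _; rewrite !linearZ; congr (_ *: _).
by apply: (can_inj hK); have := congr1 (row i) E; rewrite !rowK.
Qed.

Definition hdim X Y : nat := dimk (khom X Y).
End AlgMod.

(** * Decompositions, composition factors and local endomorphism rings *)

Section SumOf.
Variable R : pzRingType.
Implicit Types X Y Z W : lmodType R.

Lemma sub_linear X Y (f g : {linear X -> Y}) : linear (fun x => f x - g x).
Proof. by move=> a x y; rewrite !linearP /= scalerDr addrACA. Qed.
Definition lin_sub X Y (f g : {linear X -> Y}) := mk_linear (sub_linear f g).

(** Finite sums of morphisms satisfying C, up to extensional equality.
    Keeping the summation implicit makes the congruence lemmas below plain
    inductions. *)
Inductive sum_of X Y (C : {linear X -> Y} -> Prop) : {linear X -> Y} -> Prop :=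
| SumOf0 (f : {linear X -> Y}) : (forall x, f x = 0) -> sum_of C f
| SumOfS (f g h : {linear X -> Y}) :
    C g -> sum_of C h -> (forall x, f x = g x + h x) -> sum_of C f.

Lemma sum_of1 X Y (C : {linear X -> Y} -> Prop) f : C f -> sum_of C f.
Proof.
have l0 : linear (fun _ : X => 0 : Y) by move=> a x y /=; rewrite scaler0 addr0.
move=> Cf; apply: (SumOfS (h := mk_linear l0)) Cf _ _; first exact: SumOf0.
by move=> x /=; rewrite addr0.
Qed.

Lemma sum_ofD X Y (C : {linear X -> Y} -> Prop) (f g h : {linear X -> Y}) :
  sum_of C f -> sum_of C g -> (forall x, h x = f x + g x) -> sum_of C h.
Proof.
move=> Cf; elim: Cf g h => {f} [f f0|f f1 f2 Cf1 _ IH fE] g h Cg hE.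
  by rewrite (_ : h = g) //; apply: linear_ext => x; rewrite hE f0 add0r.
have lE : linear (fun x => f2 x + g x).
  by move=> a x y; rewrite !linearP /= scalerDr addrACA.
apply: (SumOfS (h := mk_linear lE)) Cf1 _ _; first exact: IH Cg _.
by move=> x /=; rewrite hE fE addrA.
Qed.

End SumOf.

Lemma sum_of_map (R R' : pzRingType) (X Y : lmodType R)
    (X' Y' : lmodType R') (F : {linear X -> Y} -> {linear X' -> Y'})
    (C : {linear X -> Y} -> Prop) (D : {linear X' -> Y'} -> Prop) f :
  (forall f : {linear X -> Y}, (forall x, f x = 0) -> forall x, F f x = 0) ->
  (forall f g h : {linear X -> Y}, (forall x, f x = g x + h x) ->
     forall x, F f x = F g x + F h x) ->
  (forall c, C c -> sum_of D (F c)) -> sum_of C f -> sum_of D (F f).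
Proof.
move=> F0 FD CD; elim=> {f} [f f0|f g h Cg _ IH fE]; first exact/SumOf0/F0.
exact: (sum_ofD (CD _ Cg) IH (FD _ _ _ fE)).
Qed.

Section SumOfComp.
Variable R : pzRingType.
Implicit Types X Y Z W : lmodType R.

Lemma sum_of_comp X Y X' Y' (a : {linear Y -> Y'}) (b : {linear X' -> X})
    (C : {linear X -> Y} -> Prop) (D : {linear X' -> Y'} -> Prop) f :
  (forall c, C c -> sum_of D (a \o c \o b)) -> sum_of C f -> sum_of D (a \o f \o b).
Proof.
apply: (@sum_of_map R R X Y X' Y' (fun f => a \o f \o b)) => /= [{}f f0 x|{}f g h fE x].
  by rewrite f0 linear0.
by rewrite fE linearD.
Qed.

Lemma sum_of_big X Y (C : {linear X -> Y} -> Prop) q (F : 'I_q -> {linear X -> Y})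
    (f : {linear X -> Y}) :
  (forall i, sum_of C (F i)) -> (forall x, f x = \sum_i F i x) -> sum_of C f.
Proof.
elim: q F f => [|q IH] F f CF fE.
  by apply: SumOf0 => x; rewrite fE big_ord0.
have lE : linear (fun x => \sum_(i < q) F (lift ord0 i) x).
  move=> a x y; rewrite scaler_sumr -big_split /=; apply: eq_bigr => i _.
  by rewrite linearP.
apply: (sum_ofD (g := mk_linear lE) (CF ord0)) => [|x].
  by apply: (IH (fun i => F (lift ord0 i))).
by rewrite fE big_ord_recl.
Qed.
End SumOfComp.

Section AlgMod.
Variables (k : fieldType) (A : falgType k).
Implicit Types X Y Z P L K Q W I : lmodType A.

Definition kdim X : nat := dimk (resk X).

Lemma kdim_inj X Y (f : {linear X -> Y}) : injective f -> fin_gen Y -> (kdim X <= kdim Y)%N.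
Proof. by move=> fI fY; apply: (@dimk_inj _ _ _ (resk_map f)) => //; apply: fin_gen_findim. Qed.

Lemma kdim_inj_surj X Y (f : {linear X -> Y}) : injective f -> fin_gen Y ->
  (kdim Y <= kdim X)%N -> surj f.
Proof.
by move=> fI fY d; apply: (@dimk_inj_surj _ _ _ (resk_map f)) => //; apply: fin_gen_findim.
Qed.

Lemma kdim_inj_lt X Y (f : {linear X -> Y}) : injective f -> fin_gen Y -> ~ surj f ->
  (kdim X < kdim Y)%N.
Proof. by move=> fI fY fS; rewrite ltnNge; apply/negP => /(kdim_inj_surj fI fY). Qed.

Lemma kdim_exact X Y Z (i : {linear X -> Y}) (q : {linear Y -> Z}) :
  injective i -> surj q -> (forall y, q y = 0 <-> exists x, i x = y) ->
  fin_gen Y -> kdim Y = (kdim X + kdim Z)%N.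
Proof.
move=> iI qS iq fY; apply: (@dimk_exact _ _ _ _ (resk_map i) (resk_map q)) => //.
exact: fin_gen_findim.
Qed.

Lemma kdim_eq0 X : fin_gen X -> (kdim X == 0)%N -> zero_mod X.
Proof.
move=> /fin_gen_findim /dimkP; rewrite -/(kdim X) => -[f fB] /eqP d0 x.
have [u <-] := bij_surj fB x; suff -> : u = 0 by rewrite linear0.
by apply/rowP => i; case: i => i ilt; exfalso; rewrite d0 in ilt.
Qed.

Lemma inj_endo_bij X (e : {linear X -> X}) : fin_gen X -> injective e -> bijective e.
Proof. by move=> fX eI; apply: inj_surj_bij => //; apply: kdim_inj_surj. Qed.

Definition factors_through (C : lmodType A -> Prop) X (e : {linear X -> X}) : Prop :=
  exists L (i : {linear L -> X}) (p : {linear X -> L}), C L /\ forall x, e x = i (p x).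

(** Writing the identity as a sum of maps through indecomposables is the
    form in which a composite through X is refined. *)
Lemma decomposition X : fin_gen X -> sum_of (@factors_through (@indecomposable A) X) idfun.
Proof.
have [d] := ubnP (kdim X); elim: d X => // d IH X dX fX.
have [X0|X0] := pselect (zero_mod X); first by apply: SumOf0 => x; apply: X0.
have [Xi|] := pselect (indecomposable X).
  by apply: sum_of1; exists X, idfun, idfun.
move=> nX; have : exists Y Z, [/\ mod_iso X (Y * Z)%type, ~ zero_mod Y & ~ zero_mod Z].
  apply: contrapT => nYZ; apply: nX; split=> // Y Z iso.
  have [Y0|Y0] := pselect (zero_mod Y); first by left.
  have [Z0|Z0] := pselect (zero_mod Z); first by right.
  by case: nYZ; exists Y, Z.
case=> Y [Z [[f /linear_bij_inv[g [fK gK]]] Y0 Z0]].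
have li : linear (fun y : Y => (y, 0) : Y * Z).
  by move=> a y y'; congr pair; rewrite /= scaler0 addr0.
have lj : linear (fun z : Z => (0, z) : Y * Z).
  by move=> a y y'; congr pair; rewrite /= scaler0 addr0.
pose i : {linear Y -> X} := g \o mk_linear li.
pose j : {linear Z -> X} := g \o mk_linear lj.
have lp : linear (fun x : X => (f x).1) by move=> a x y; rewrite linearP.
have lq : linear (fun x : X => (f x).2) by move=> a x y; rewrite linearP.
pose p := mk_linear lp; pose q := mk_linear lq.
have iI : injective i by move=> y y' /(can_inj gK)[].
have jI : injective j by move=> y y' /(can_inj gK)[].
have dY : (kdim Y < d)%N.
  apply: (leq_trans _ (dX : (kdim X <= d)%N)); apply: kdim_inj_lt iI fX _ => iS.
  apply: Z0 => z; have [y /(can_inj gK)[_ ->//]] := iS (j z).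
have dZ : (kdim Z < d)%N.
  apply: (leq_trans _ (dX : (kdim X <= d)%N)); apply: kdim_inj_lt jI fX _ => iS.
  apply: Y0 => z; have [y /(can_inj gK)[->//]] := iS (i z).
have sub (W : lmodType A) (a : {linear W -> X}) (b : {linear X -> W}) :
    sum_of (@factors_through (@indecomposable A) W) idfun ->
    sum_of (@factors_through (@indecomposable A) X) (a \o idfun \o b).
  apply: sum_of_comp => c [L [u [v [Li cE]]]]; apply: sum_of1.
  by exists L, (a \o u), (v \o b); split=> // x /=; rewrite cE.
apply: (sum_ofD (sub _ i p (IH _ dY (fin_gen_inj iI fX)))
                (sub _ j q (IH _ dZ (fin_gen_inj jI fX)))) => x /=.
rewrite -linearD -[LHS]fK; congr (g _).
by rewrite [LHS]surjective_pairing; congr pair; rewrite /= ?addr0 ?add0r.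
Qed.

Lemma simple_sub Y : fin_gen Y -> ~ zero_mod Y ->
  exists L (j : {linear L -> Y}), simple_mod L /\ injective j.
Proof.
have [d] := ubnP (kdim Y); elim: d Y => // d IH Y dY fY Y0.
have [Ys|] := pselect (simple_mod Y); first by exists Y, idfun; split.
move=> nY; have : exists S : {pred Y}, [/\ submod_closed S,
    exists2 x, x \in S & x != 0 & exists x, x \notin S].
  apply: contrapT => nS; apply: nY; split=> // S Sc.
  have [[x xS]|nx] := pselect (exists x, x \notin S); last first.
    by right=> x; apply: contrapT => /negP xS; apply: nx; exists x.
  left=> y; apply/idP/eqP => [yS|->]; last by case: Sc.
  apply: contrapT => /eqP y0; apply: nS; exists S; split=> //; last by exists x.
  by exists y.
case=> S [[S0 SP] [x xS x0] [y yS]].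
have [|K [j [jI jP]]] := @submodule_ex A Y (fun x => x \in S).
  split=> // [u v uS vS|a u uS]; first by have := SP 1 u v uS vS; rewrite scale1r.
  by have := SP a u 0 uS S0; rewrite addr0.
have [||L [i [Ls iI]]] := IH K _ (fin_gen_inj jI fY).
- apply: (leq_trans _ (dY : (kdim Y <= d)%N)); apply: kdim_inj_lt jI fY _ => jS.
  by case/negP: yS; apply/jP.
- move=> K0; have /jP[z zx] := xS.
  by case/eqP: x0; rewrite -zx (K0 z) linear0.
by exists L, (j \o i); split=> // u v /= /jI /iI.
Qed.

(** Projectivity of P makes Hom(P, -) exact. *)
Lemma hdim_exact P X Y Z (i : {linear X -> Y}) (q : {linear Y -> Z}) :
  fin_gen P -> projective P -> fin_gen Y ->
  injective i -> surj q -> (forall y, q y = 0 <-> exists x, i x = y) ->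
  hdim P Y = (hdim P X + hdim P Z)%N.
Proof.
move=> fP pP fY iI qS iq.
apply: (@dimk_exact _ _ _ _ (khom_post P i) (khom_post P q)).
- move=> f g /= E; apply: homP => x; apply: iI.
  exact: (congr1 (fun h : khom P Y => h x) E).
- by move=> f; have [h fh] := pP _ _ q f qS; exists h; apply: homP => x /=.
- move=> f; split=> [E|[g <-]]; last first.
    by apply: homP => x /=; apply/iq; exists (g x).
  have [|g gP] := @lift_along_inj A Y P X i f iI.
    by move=> x; apply/iq; exact: (congr1 (fun h : khom P Z => h x) E).
  by exists g; apply: homP => x /=.
exact: khom_findim.
Qed.

(** The extension property says that Hom(Q, W) -> Hom(K, W) is onto; for K
    -> Q -> X a projective presentation it is the vanishing of Ext^1(X, W). *)
Lemma hdim_coexact K Q X W (j : {linear K -> Q}) (q : {linear Q -> X}) :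
  fin_gen Q -> fin_gen W -> injective j -> surj q ->
  (forall y, q y = 0 <-> exists x, j x = y) ->
  (forall f : {linear K -> W}, exists g : {linear Q -> W}, forall x, g (j x) = f x) ->
  hdim Q W = (hdim X W + hdim K W)%N.
Proof.
move=> fQ fW jI qS jq ext.
apply: (@dimk_exact _ _ _ _ (khom_pre W q) (khom_pre W j)).
- move=> f g /= E; apply: homP => x; have [y <-] := qS x.
  exact: (congr1 (fun h : khom Q W => h y) E).
- by move=> f; have [g gP] := ext f; exists g; apply: homP => x /=.
- move=> f; split=> [E|[g <-]]; last first.
    apply: homP => x /=; rewrite (_ : q (j x) = 0) ?linear0 //.
    by apply/jq; exists x.
  have [|g gP] := @factor_through_surj A Q W X q f qS.
    by move=> x /jq[y <-]; exact: (congr1 (fun h : khom K W => h y) E).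
  by exists g; apply: homP => x /=.
exact: khom_findim.
Qed.

Lemma hdim_iso P X Y : fin_gen P -> fin_gen X -> mod_iso X Y -> hdim P X = hdim P Y.
Proof.
move=> fP fX [f /linear_bij_inv[g [fK gK]]].
apply: (@dimk_iso _ _ _ (khom_post P f)); last exact: khom_findim.
by exists (khom_post P g) => h; apply: homP => x /=; rewrite ?fK ?gK.
Qed.

Lemma hdim_zero P X : (forall f : {linear P -> X}, forall x, f x = 0) -> hdim P X = 0%N.
Proof.
move=> h0; apply: dimkE.
have l0 : linear (fun _ : 'rV[k]_0 => 0 : khom P X) by move=> a x y /=; rewrite scaler0 addr0.
exists (mk_linear l0); apply: inj_surj_bij => [x y _|f].
  by rewrite [x]thinmx0 [y]thinmx0.
by exists 0; apply: homP => x /=; rewrite h0.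
Qed.

(** The numbers [c j] are the multiplicities in a composition series.
    Dimensions of Hom from a projective add up along the series, and the
    series is empty only for zero. *)
Lemma composition_factors n (S : 'I_n -> lmodType A) Y :
  (forall X, simple_mod X -> exists i, mod_iso X (S i)) -> fin_gen Y ->
  exists c : 'I_n -> nat,
    (forall P, fin_gen P -> projective P ->
       hdim P Y = (\sum_j c j * hdim P (S j))%N) /\
    ((forall j, c j = 0%N) -> zero_mod Y).
Proof.
move=> SP; have [d] := ubnP (kdim Y); elim: d Y => // d IH Y dY fY.
have [Y0|Y0] := pselect (zero_mod Y).
  exists (fun=> 0%N); split=> // P _ _; rewrite big1 // hdim_zero // => f x; exact: Y0.
have [L [i [Ls iI]]] := simple_sub fY Y0.
have [|Z [q [qS qi]]] := @quotient_ex A Y (fun y => exists x, i x = y).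
  split=> [|_ _ [x <-] [y <-]|a _ [x <-]]; first by exists 0; rewrite linear0.
    by exists (x + y); rewrite linearD.
  by exists (a *: x); rewrite linearZ.
have fL := fin_gen_inj iI fY.
have fZ := fin_gen_surj qS fY.
have [|c [cE _]] := IH Z _ fZ.
  apply: (leq_trans _ (dY : (kdim Y <= d)%N)); rewrite (kdim_exact iI qS qi fY).
  rewrite -[leqLHS]add1n leq_add2r lt0n.
  by apply/negP => /(kdim_eq0 fL); case: Ls.
have [s Lsi] := SP L Ls.
exists (fun j => (c j + (j == s))%N); split=> [P fP pP|/(_ s)]; last by rewrite eqxx addn1.
rewrite (hdim_exact fP pP fY iI qS qi) cE // (hdim_iso fP fL Lsi) addnC.
under [RHS]eq_bigr do rewrite mulnDl.
rewrite big_split /=; congr (_ + _)%N.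
by rewrite (bigD1 s) //= eqxx mul1n big1 ?addn0 // => j /negPf ->.
Qed.

Lemma iter_linear X (e : {linear X -> X}) m : linear (iter m e).
Proof. by elim: m => [|m IH] a x y //=; rewrite IH linearP. Qed.
Definition iter_lin X (e : {linear X -> X}) m : {linear X -> X} := mk_linear (iter_linear e m).

(** The dimensions of the kernels of the powers of e are bounded; at a power
    where the dimension is largest the kernels become stationary. *)
Lemma fitting_index X (e : {linear X -> X}) : fin_gen X ->
  exists m, forall x, iter (m.+1 + m.+1) e x = 0 -> iter m.+1 e x = 0.
Proof.
move=> fX.
pose Q d := `[< exists m K (j : {linear K -> X}), [/\ injective j,
  forall x, iter m.+1 e x = 0 <-> exists y, j y = x & kdim K = d] >].
have exQ : exists d, Q d.
  have [K [j [jI jP]]] := kernel_ex (iter_lin e 1).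
  by exists (kdim K); apply/asboolP; exists 0%N, K, j.
have bQ d : Q d -> (d <= kdim X)%N.
  by move=> /asboolP[m [K [j [jI _ <-]]]]; apply: kdim_inj jI fX.
(* Exponents m + 1 avoid the zeroth power, for which stationarity is
   trivial. *)
case: (ex_maxnP exQ bQ) => d /asboolP[m [K [j [jI jP dK]]]] dmax.
exists m => x xm.
have [K' [j' [jI' jP']]] := kernel_ex (iter_lin e (m.+1 + m.+1)).
have [i iP] : exists i : {linear K -> K'}, forall y, j' (i y) = j y.
  apply: lift_along_inj => // y; apply/jP'; have /jP jy0 : exists z, j z = j y by exists y.
  by rewrite /= -/(iter (m.+1 + m.+1) e (j y)) iterD jy0; exact: (linear0 (iter_lin e m.+1)).
have iI : injective i by move=> y z E; apply: jI; rewrite -!iP E.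
have fK' := fin_gen_inj jI' fX.
have [|y yx] := kdim_inj_surj iI fK' _ (sval (cid (iffLR (jP' x) xm))).
  rewrite dK; apply: dmax; apply/asboolP; exists (m + m.+1)%N, K', j'; split=> //.
apply/jP; exists y; rewrite -iP yx; exact: (svalP (cid (iffLR (jP' x) xm))).
Qed.

(** Fitting's lemma. On the image I of a power E of e with ker E = ker E^2,
    the map E is bijective; the inverse gives an idempotent with image I and
    kernel ker E, which is 0 or 1. *)
Lemma fitting X (e : {linear X -> X}) : indecomposable X ->
  bijective e \/ exists m, forall x, iter m e x = 0.
Proof.
move=> Xi; have fX := indec_fg Xi; have [m mP] := fitting_index e fX.
(* The exponent m + 1 is positive, so that E injective forces e injective. *)
pose E := iter_lin e m.+1.
have [|I [i [iI iP]]] := @submodule_ex A X (fun y => exists x, E x = y).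
  split=> [|_ _ [x <-] [y <-]|a _ [x <-]]; first by exists 0; rewrite linear0.
    by exists (x + y); rewrite linearD.
  by exists (a *: x); rewrite linearZ.
have [|E' E'P] := @lift_along_inj A X X I i E iI; first by move=> x; apply/iP; exists x.
have rI : injective (E' \o i).
  apply: linear_inj => y /= /(congr1 i); rewrite E'P linear0 => Eiy.
  have /iP[x xy] : exists z, i z = i y by exists y.
  apply: iI; rewrite linear0 -xy; apply: mP; rewrite iterD.
  by move: Eiy; rewrite -xy.
have fI := fin_gen_inj iI fX.
have [s [rK sK]] := linear_bij_inv (inj_endo_bij fI rI).
have [|p1|p0] := indec_idem (e := i \o s \o E') Xi.
- by move=> x /=; rewrite [s (E' _)](rK (s (E' x))).
- left; apply: inj_endo_bij fX _; apply: linear_inj => x ex.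
  rewrite -(p1 x) /=; suff -> : E' x = 0 by rewrite !linear0.
  by apply: iI; rewrite E'P linear0 /= -iterS iterSr ex; exact: (linear0 (iter_lin e m)).
- right; exists m.+1 => x; have <- : i (E' x) = iter m.+1 e x by rewrite E'P.
  have := p0 x => /=; move=> /(congr1 E'); rewrite linear0.
  by rewrite [E' (i _)](sK (E' x)) => ->; rewrite linear0.
Qed.

Lemma surj_endo_bij X (e : {linear X -> X}) : indecomposable X -> surj e -> bijective e.
Proof.
move=> Xi eS; have [//|[m m0]] := fitting e Xi; case: (indec_nz Xi) => x.
have iS : surj (iter m e).
  elim: m {m0} => [|m IH] y; first by exists y.
  by have [z <-] := eS y; have [w <-] := IH z; exists w.
by have [y <-] := iS x; rewrite m0.
Qed.

Lemma nonunit_1sub X (e : {linear X -> X}) : indecomposable X -> ~ bijective e ->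
  bijective (lin_sub idfun e).
Proof.
move=> Xi eN; have [//|[m m0]] := fitting e Xi.
apply: inj_endo_bij (indec_fg Xi) _; apply: linear_inj => x /= /eqP.
rewrite subr_eq0 => /eqP xe; rewrite -(m0 x).
by elim: m {m0} => //= m <-.
Qed.

(** The non-bijective endomorphisms of an indecomposable form an ideal: if a
    + b had inverse v, then v b = 1 - v a would be bijective. *)
Lemma nonunitD X (a b c : {linear X -> X}) : indecomposable X ->
  ~ bijective a -> ~ bijective b -> (forall x, c x = a x + b x) -> ~ bijective c.
Proof.
move=> Xi aN bN cE /linear_bij_inv[v [cK vK]].
have inj (f : {linear X -> X}) : ~ bijective f -> ~ bijective (v \o f).
  move=> fN vf; apply: fN; apply: inj_endo_bij (indec_fg Xi) _ => x y fxy.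
  by apply: (bij_inj vf); rewrite /= fxy.
have E : (v \o b : {linear X -> X}) = lin_sub idfun (v \o a).
  apply: linear_ext => x /=; rewrite -{2}(cK x) -linearB; congr (v _).
  by rewrite cE addrC addKr.
by apply: (inj b bN); have := nonunit_1sub Xi (inj a aN); rewrite -E.
Qed.

Lemma nonunit_compr X (a b : {linear X -> X}) : indecomposable X ->
  ~ bijective a -> ~ bijective (a \o b).
Proof.
move=> Xi aN ab; apply: aN; apply: surj_endo_bij Xi _ => x.
by have [y <-] := bij_surj ab x; exists (b y).
Qed.

Section Nakayama.
Variables (X : lmodType A) (U : X -> Prop).
Hypothesis Xi : indecomposable X.
Hypotheses (U0 : U 0) (UD : forall x y, U x -> U y -> U (x + y))
  (Ue : forall (e : {linear X -> X}) x, U x -> U (e x)).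

(** The set U + sum of C y over y in ys; a recursion on ys suits the removal
    of one generator at a time. *)
Fixpoint end_span (C : {linear X -> X} -> Prop) (ys : seq X) (x : X) : Prop :=
  if ys is y :: ys then exists e, C e /\ end_span C ys (x - e y) else U x.

Lemma end_spanD (C : {linear X -> X} -> Prop) ys x x' :
  (forall a b c : {linear X -> X}, C a -> C b -> (forall x, c x = a x + b x) -> C c) ->
  end_span C ys x -> end_span C ys x' -> end_span C ys (x + x').
Proof.
move=> CD; elim: ys x x' => [|y ys IH] x x' /=; first exact: UD.
case=> e [Ce xe] [e' [Ce' xe']].
have lE : linear (fun x => e x + e' x).
  by move=> a u v; rewrite !linearP /= scalerDr addrACA.
exists (mk_linear lE); split; first exact: CD Ce Ce' _.
by rewrite /= opprD addrACA; apply: IH.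
Qed.

Lemma end_span_map (C D : {linear X -> X} -> Prop) (f : {linear X -> X}) ys x :
  (forall e, C e -> D (f \o e)) -> end_span C ys x -> end_span D ys (f x).
Proof.
move=> CD; elim: ys x => [|y ys IH] x /=; first exact: Ue.
case=> e [Ce xe]; exists (f \o e); split; first exact: CD.
by rewrite /= -linearB; apply: IH.
Qed.

Lemma end_spanW (C D : {linear X -> X} -> Prop) ys x :
  (forall e, C e -> D e) -> end_span C ys x -> end_span D ys x.
Proof.
move=> CD; elim: ys x => [|y ys IH] x //= [e [Ce xe]].
by exists e; split; [exact: CD|exact: IH].
Qed.

Let T (_ : {linear X -> X}) := True.
Let J (e : {linear X -> X}) := ~ bijective e.

Lemma zero_linear_nonunit : exists z : {linear X -> X}, J z /\ forall x, z x = 0.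
Proof.
have l0 : linear (fun _ : X => 0 : X) by move=> a x y /=; rewrite scaler0 addr0.
exists (mk_linear l0); split=> // /bij_surj S; apply: (indec_nz Xi) => x.
by have [y <-] := S x.
Qed.

Lemma end_span_base (C : {linear X -> X} -> Prop) ys x :
  (exists z : {linear X -> X}, C z /\ forall x, z x = 0) -> U x -> end_span C ys x.
Proof.
move=> [z [Cz z0]] Ux; elim: ys => //= y ys IH.
by exists z; split=> //; rewrite z0 subr0.
Qed.

(** Nakayama's lemma for X over the local ring End(X): if X = U + J X with J
    the radical of End(X), then X = U. Generators y are removed one at a
    time: writing y = e y + (combination of the others and U) with e in J,
    the bijection 1 - e expresses y by the others. *)
Lemma nakayama : fin_gen X ->
  (forall V : X -> Prop, (forall x, U x -> V x) -> (forall x y, V x -> V y -> V (x + y)) ->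
     (forall (r : {linear X -> X}) x, ~ bijective r -> V (r x)) -> forall x, V x) ->
  forall x, U x.
Proof.
move=> fX UJ.
have [n [v vP]] := findim_basis (fin_gen_findim fX).
have [z [Jz z0]] := zero_linear_nonunit.
have step ys : (forall x, end_span T ys x) -> forall x, U x.
  elim: ys => [|y ys IH] // Tx; apply: IH.
  have Jx x : end_span J (y :: ys) x.
    apply: (UJ (end_span J (y :: ys))) => [{}x Ux|x1 x2|r {}x Jr].
    - by apply: end_span_base => //; exists z.
    - by apply: end_spanD => a b c; apply: nonunitD.
    - apply: (@end_span_map T) (Tx x) => e _; exact: nonunit_compr.
  have [e [/(nonunit_1sub Xi)/linear_bij_inv[w [wK Kw]] ye]] := Jx y.
  have Ty : end_span T ys y.
    rewrite -[y]wK; apply: (@end_span_map T) => //.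
    exact: (end_spanW _ ye).
  move=> x; have [e' [_ xe]] := Tx x; rewrite -(subrK (e' y) x); apply: end_spanD => //.
  exact: (@end_span_map T).
apply: (step (map v (enum 'I_n))) => x.
have [c ->] := vP x; rewrite -big_enum /=.
elim: (enum 'I_n) => [|i s IH] /=; first by rewrite big_nil.
have lc : linear (fun x : X => (c i)%:A *: x).
  by move=> a x1 x2; rewrite scalerDr !scalerA scalarA_central.
exists (mk_linear lc); split=> //; rewrite big_cons.
set S := \sum_(j <- s) _.
suff -> : c i *: (v i : resk X) + S - mk_linear lc (v i) = S by [].
by rewrite addrAC; rewrite (_ : _ - _ = 0) ?add0r //; exact: subrr.
Qed.
End Nakayama.
End AlgMod.

(** * Projective presentations and Ext *)

Section Cover.
Variable R : pzRingType.
Implicit Types X Y Z W K Q T P : lmodType R.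

Definition presentation K Q T (j : {linear K -> Q}) (g : {linear Q -> T}) : Prop :=
  [/\ projective Q, injective j, surj g & forall x, g x = 0 <-> exists y, j y = x].

(** For a presentation of T this says that Ext^1(T, X) = 0, in a form that
    can be moved from one presentation to another. *)
Definition extends K Q (j : {linear K -> Q}) X : Prop :=
  forall f : {linear K -> X}, exists h : {linear Q -> X}, forall y, h (j y) = f y.

Lemma presentation_ex Q T (g : {linear Q -> T}) : projective Q -> surj g ->
  exists K (j : {linear K -> Q}), presentation j g.
Proof. by move=> pQ gS; have [K [j [jI jP]]] := kernel_ex g; exists K, j. Qed.

Lemma Ext1_presentation T X : Ext1_zero T X ->
  exists K Q (j : {linear K -> Q}) (g : {linear Q -> T}), presentation j g /\ extends j X.
Proof.
case=> -[P d aug fP pP augS augP dP] /= ext.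
have [K [j jg]] := presentation_ex (pP 0%N) augS; exists K, (P 0%N), j, aug; split=> // f.
case: jg => _ jI _ jP.
have [d' d'E] : exists d' : {linear P 1%N -> K}, forall y, j (d' y) = d 0%N y.
  by apply: lift_along_inj => // y; apply/jP/augP; exists y.
have [|h hE] := ext (f \o d').
  move=> z /=; suff -> : d' (d 1%N z) = 0 by rewrite linear0.
  by apply: jI; rewrite d'E linear0; apply/dP; exists z.
exists h => y; have /augP[z zy] : aug (j y) = 0 by apply/jP; exists y.
have -> : y = d' z by apply: jI; rewrite d'E zy.
by rewrite d'E; exact: (esym (hE z)).
Qed.

(** Projective dimension at most one makes the first syzygy of the given
    resolution projective, and the vanishing of Ext^1 is tested on that
    resolution. *)
Lemma pd1_presentation T : pd_le T 1 ->
  exists K Q (j : {linear K -> Q}) (g : {linear Q -> T}),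
  [/\ presentation j g, projective K, fin_gen Q & forall X, extends j X -> Ext1_zero T X].
Proof.
case=> P P0; exists (P 1%N), (P 0%N).
case: P P0 => P d aug fP pP augS augP dP /= P0; exists (d 0%N), aug; split=> //.
- split=> //; apply: linear_inj => x /dP[z <-].
  by rewrite (P0 2%N isT z) linear0.
- move=> X ext; exists (ProjResolution fP pP augS augP dP) => f _.
  by have [h hE] := ext f; exists h => y; rewrite /= hE.
Qed.

Section Compare.
Variables (T T' : lmodType R) (i : {linear T' -> T}) (p : {linear T -> T'}).
Hypothesis ipK : cancel i p.
Variables (K Q K' Q' : lmodType R).
Variables (j : {linear K -> Q}) (g : {linear Q -> T}).
Variables (j' : {linear K' -> Q'}) (g' : {linear Q' -> T'}).
Hypotheses (jg : presentation j g) (jg' : presentation j' g').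

(** The comparison theorem for presentations of T and of a direct summand T'
    of T: lifts a and b of the inclusion and of the projection, together
    with the homotopy c from b a to the identity. *)
Lemma presentation_compare : exists (a : {linear Q' -> Q}) (b : {linear Q -> Q'})
    (a' : {linear K' -> K}) (b' : {linear K -> K'}) (c : {linear Q' -> K'}),
  [/\ forall y, j (a' y) = a (j' y), forall y, j' (b' y) = b (j y)
    & forall x, j' (c x) = x - b (a x)].
Proof.
case: jg jg' => pQ jI gS jP [pQ' jI' gS' jP'].
have [a aE] := pQ' _ _ g (i \o g') gS.
have [b bE] := pQ _ _ g' (p \o g) gS'.
have [a' a'E] : exists a' : {linear K' -> K}, forall y, j (a' y) = (a \o j') y.
  apply: lift_along_inj => // y; apply/jP => /=; rewrite -[LHS]aE /=.
  by rewrite (_ : g' (j' y) = 0) ?linear0 //; apply/jP'; exists y.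
have [b' b'E] : exists b' : {linear K -> K'}, forall y, j' (b' y) = (b \o j) y.
  apply: lift_along_inj => // y; apply/jP' => /=; rewrite -[LHS]bE /=.
  by rewrite (_ : g (j y) = 0) ?linear0 //; apply/jP; exists y.
have [c cE] : exists c : {linear Q' -> K'},
    forall x, j' (c x) = lin_sub idfun (b \o a : {linear Q' -> Q'}) x.
  apply: lift_along_inj => // x; apply/jP' => /=; rewrite linearB /=.
  by rewrite -[g' (b _)]bE /= -[g (a _)]aE /= ipK subrr.
by exists a, b, a', b', c.
Qed.

(** A map f on K' is transported to K, extended to Q and pulled back to Q';
    the homotopy corrects the difference. *)
Lemma presentation_extends X : extends j X -> extends j' X.
Proof.
move=> ext f; have [a [b [a' [b' [c [a'E b'E cE]]]]]] := presentation_compare.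
have [h hE] := ext (f \o b').
(* x = c x + b (a x) splits an element of Q' into a part in K', where f is
   given, and a part coming from Q. *)
have lF : linear (fun x => f (c x) + h (a x)).
  by move=> r x y; rewrite !linearP /= scalerDr addrACA.
exists (mk_linear lF) => y /=; rewrite -a'E hE /= -linearD; congr (f _).
case: jg' => _ jI' _ _; apply: jI'.
by rewrite linearD /= cE b'E a'E subrK.
Qed.

(** Same homotopy argument: K' is projective because K and Q' are. *)
Lemma presentation_proj : projective K -> projective K'.
Proof.
move=> pK Y Z q f qS; have [a [b [a' [b' [c [a'E b'E cE]]]]]] := presentation_compare.
have [h hE] := pK _ _ q (f \o b') qS.
case: jg' => pQ' jI' _ _.
have [h' h'E] := pQ' _ _ q (f \o c) qS.
have lF : linear (fun y => h' (j' y) + h (a' y)).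
  by move=> r x y; rewrite !linearP /= scalerDr addrACA.
exists (mk_linear lF) => y /=; rewrite linearD /= -[q (h' _)]h'E -[q (h _)]hE /= -linearD.
by congr (f _); apply: jI'; rewrite linearD /= cE b'E a'E subrK.
Qed.
End Compare.

Lemma presentation_extends_id T K Q K' Q' (j : {linear K -> Q}) (g : {linear Q -> T})
  (j' : {linear K' -> Q'}) (g' : {linear Q' -> T}) X :
  presentation j g -> presentation j' g' -> extends j X -> extends j' X.
Proof.
move=> jg jg'; apply: (@presentation_extends T T idfun idfun _ _ _ _ _ _ _ _ _ jg jg').
by [].
Qed.

Lemma Ext1_extends T K Q (j : {linear K -> Q}) (g : {linear Q -> T}) X :
  presentation j g -> Ext1_zero T X -> extends j X.
Proof.
by move=> jg /Ext1_presentation[K' [Q' [j' [g' [jg' ext]]]]]; apply: presentation_extends_id jg' jg ext.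
Qed.

End Cover.

(** The maps [u i] generate Hom(T, X) as a module over End(T). *)
Definition hom_gens (R : pzRingType) (T X : lmodType R) r (u : 'I_r -> homR T X) : Prop :=
  forall v : homR T X, exists w : 'I_r -> endo T, forall t, v t = \sum_i u i (w i t).

Section Tilt.
Variables (k : fieldType) (A : falgType k) (T : lmodType A).
Hypothesis tT : tilting T.
Implicit Types X Y Z P L K Q W I : lmodType A.

Let fT : fin_gen T. Proof. by case: tT. Qed.
Let TT : torsion T T. Proof. by case: tT. Qed.

Lemma summand_retract X Y : summand X Y ->
  exists (i : {linear X -> Y}) (p : {linear Y -> X}), cancel i p.
Proof.
case=> Z [f /linear_bij_inv[g [fK gK]]].
have li : linear (fun y : X => (y, 0) : X * Z).
  by move=> a y y'; congr pair; rewrite /= scaler0 addr0.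
have lp : linear (fun x : Y => (f x).1) by move=> a x y; rewrite linearP.
by exists (g \o mk_linear li), (mk_linear lp) => x /=; rewrite gK.
Qed.

Lemma gen_T_im X : gen_by (only T) X ->
  fin_gen X -> exists r (u : 'I_r -> {linear T -> X}), surj (dpow_copair u).
Proof.
move=> gX fX; have [r [u uP]] := findim_basis (khom_findim fT fX).
exists r, u => x; apply: (gX x (fun x => exists t, dpow_copair u t = x)).
- by exists 0; rewrite linear0.
- by move=> _ _ [t <-] [t' <-]; exists (t + t'); rewrite linearD.
- move=> Z v t ZT; move: v t; rewrite ZT => v t; have [c ->] := uP v.
  exists [ffun i => (c i)%:A *: t] => /=; rewrite khom_sumE.
  by apply: eq_bigr => i _; rewrite ffunE linearZ.
Qed.

(** Even a k-basis of Hom(T, X) will do, as k acts through End(T). *)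
Lemma fin_gen_hom_gens X : fin_gen X -> exists r (u : 'I_r -> homR T X), hom_gens u.
Proof.
move=> fX; have [r [u uP]] := findim_basis (khom_findim fT fX).
exists r, u => v; have [c ->] := uP v.
have lw i : linear (fun t : T => (c i)%:A *: t).
  by move=> a x y; rewrite scalerDr !scalerA scalarA_central.
exists (fun i => mk_linear (lw i)) => t /=; rewrite khom_sumE.
by apply: eq_bigr => i _; rewrite linearZ.
Qed.

(** The obstruction to Ext^1(T, -) being right exact is Ext^2(T, -), which
    vanishes: maps from the projective syzygy K lift along X -> Y. *)
Lemma torsion_quot X Y (f : {linear X -> Y}) : surj f -> torsion T X -> torsion T Y.
Proof.
move=> fS [fX EX]; split; first exact: fin_gen_surj fS fX.
case: tT => _ /pd1_presentation[K [Q [j [g [jg pK _ ext]]]]] _ _; apply: ext => h.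
have [h' h'E] := pK _ _ f h fS.
have [h2 h2E] := Ext1_extends jg EX h'.
by exists (f \o h2) => y /=; rewrite h2E; exact: (esym (h'E y)).
Qed.

Lemma torsion_dpow r : torsion T (dpow T r).
Proof.
split; first exact: fin_gen_dpow.
case: tT => _ /pd1_presentation[K [Q [j [g [jg pK _ ext]]]]] ET _; apply: ext => f.
have [h hE] := choice (fun i => Ext1_extends jg ET (dpow_pr T i \o f)).
by exists (dpow_pair h) => y; apply/ffunP => i; rewrite ffunE hE.
Qed.

Lemma gen_torsion X : fin_gen X -> gen_by (only T) X -> torsion T X.
Proof.
move=> fX gX; have [r [u uS]] := gen_T_im gX fX.
exact: torsion_quot uS (torsion_dpow r).
Qed.

(** In the long exact sequence for 0 -> L -> T^r -> X -> 0 the map Hom(T,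
    T^r) -> Hom(T, X) is onto by choice of u, so Ext^1(T, L) embeds into
    Ext^1(T, T^r) = 0. *)
Lemma torsion_kernel X r (u : 'I_r -> homR T X) L (j : {linear L -> dpow T r}) :
  hom_gens u -> injective j -> (forall x, dpow_copair u x = 0 <-> exists y, j y = x) ->
  torsion T L.
Proof.
move=> uP jI jP; split.
  exact: fin_gen_inj jI (fin_gen_dpow r fT).
case: tT => _ /pd1_presentation[K [Q [i [g [ig pK _ ext]]]]] _ _; apply: ext => f.
case: (torsion_dpow r) => _ /(Ext1_extends ig)/(_ (j \o f))[h hE].
case: (ig) => _ iI gS iP.
have [|v vE] := @factor_through_surj A Q X T g (dpow_copair u \o h) gS.
  by move=> x /iP[y <-]; rewrite [LHS](_ : _ = dpow_copair u (h (i y))) // hE; apply/jP; exists (f y).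
have [w wE] := uP v.
have [h' h'E] : exists h' : {linear Q -> L}, forall x, j (h' x) = lin_sub h (dpow_pair w \o g) x.
  apply: lift_along_inj => // x; apply/jP; rewrite linearB.
  have -> : dpow_copair u (h x) = v (g x) by rewrite vE.
  rewrite wE /= -sumrB big1 // => l _; rewrite ffunE; exact: subrr.
exists h' => y; apply: jI; rewrite h'E.
have -> : lin_sub h (dpow_pair w \o g) (i y) = h (i y) - dpow_pair w (g (i y)) by [].
have -> : g (i y) = 0 by apply/iP; exists y.
by rewrite linear0 subr0 hE.
Qed.

(** The trace lies in Gen T, so Ext^1(T, trace) = 0 and every map T -> X /
    trace lifts to a map T -> X, whose image is in the trace. *)
Lemma trace_quot_free X Z (q : {linear X -> Z}) : fin_gen X -> surj q ->
  (forall x, q x = 0 <-> trace (only T) x) -> forall f : {linear T -> Z}, forall t, f t = 0.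
Proof.
move=> fX qS qP f.
have [I [i [iI iP gI]]] := trace_ex (only T) X.
have [_ EI] := gen_torsion (fin_gen_inj iI fX) gI.
case: tT => _ /pd1_presentation[K [Q [j [g [jg pK _ ext]]]]] _ _.
case: (jg) => pQ jI gS jP.
have [h hE] := pQ _ _ q (f \o g) qS.
have [f' f'E] : exists f' : {linear K -> I}, forall y, i (f' y) = (h \o j) y.
  apply: lift_along_inj => // y; apply/iP/qP; rewrite -[LHS]hE /=.
  by rewrite (_ : g (j y) = 0) ?linear0 //; apply/jP; exists y.
have [h' h'E] := Ext1_extends jg EI f'.
have [|v vE] := @factor_through_surj A Q X T g (lin_sub h (i \o h')) gS.
  by move=> x /jP[y <-] /=; rewrite h'E f'E subrr.
move=> t; have [x <-] := gS t; rewrite [LHS]hE /=; apply/qP.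
have -> : h x = v (g x) + i (h' x) by rewrite vE /= subrK.
by apply: traceD; [apply: trace_im|apply/iP; exists (h' x)].
Qed.
End Tilt.

(** * The torsion class consists of the modules generated by T *)

Section Family.
Variables (k : fieldType) (A : falgType k).
Implicit Types X Y Z P L K Q W I : lmodType A.
Variables (n : nat) (Ts : 'I_n -> lmodType A).
Hypothesis Ts_indec : forall i, indecomposable (Ts i).
Hypothesis Ts_inj : forall i j, mod_iso (Ts i) (Ts j) -> i = j.

Definition fam (D : {set 'I_n}) X : Prop := exists2 i, i \in D & X = Ts i.

Lemma gen_by_fam0 X : gen_by (fam set0) X -> zero_mod X.
Proof.
move=> gX x; apply: (gX x (fun x => x = 0)) => // [_ _ -> ->|Z u t [i]].
  exact: addr0.
by rewrite inE.
Qed.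

(** Choose S minimal in D such that the Ts i with i in S still generate all
    of D. For s in S, the module Ts s is generated by E and hence by S
    through E. A composite Ts s -> Ts j -> Ts s with j in E is never
    bijective, so Ts s = U + J (Ts s), with J the non-bijective
    endomorphisms and U the trace of the other members of S; by Nakayama's
    lemma s can be removed from S. *)
Lemma fam_mutual_gen (D E : {set 'I_n}) : [disjoint D & E] ->
  (forall i, i \in D -> gen_by (fam E) (Ts i)) ->
  (forall i, i \in E -> gen_by (fam D) (Ts i)) ->
  D = set0.
Proof.
move=> DE gD gE.
pose Q (S : {set 'I_n}) := (S \subset D) && `[< forall i, i \in D -> gen_by (fam S) (Ts i) >].
have QD : exists S, Q S.
  exists D; rewrite /Q subxx; apply/asboolP => i iD x.
  apply: (trace_trans _ (gD i iD x)) => Z [j jE ->]; exact: gE.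
case: (ex_minset QD) => S /minsetP[/andP[SD /asboolP gS] Smin].
have [S0|[s sS]] := set_0Vmem S.
  apply/setP => i; rewrite inE; apply/negP => iD.
  apply: (indec_nz (Ts_indec i)); apply: gen_by_fam0; rewrite -S0; exact: gS.
suff gs : gen_by (fam (S :\ s)) (Ts s).
  have : S :\ s = S.
    apply: Smin; last exact: subsetDl.
    apply/andP; split; first by apply: subset_trans SD; apply: subsetDl.
    apply/asboolP => i iD x; apply: (trace_trans _ (gS i iD x)) => Z [l lS ->].
    have [->//|ls y] := eqVneq l s.
    by apply: (trace_im idfun y); exists l => //; rewrite !inE ls.
  by move/setP/(_ s); rewrite !inE eqxx sS.
have sD : s \in D by apply: (subsetP SD).
apply: (@nakayama k A (Ts s) (@trace A (fam (S :\ s)) (Ts s)) (Ts_indec s)).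
- exact: trace0.
- by move=> x y; apply: traceD.
- by move=> e x; apply: trace_map.
- exact: indec_fg.
move=> V UV VD Vr x; have V0 : V 0 by apply: UV; exact: trace0.
apply: (gD s sD x) => // Z u t [j jE ZE]; move: u t; rewrite {Z}ZE => u t.
have gj : gen_by (fam S) (Ts j).
  move=> y; apply: (trace_trans _ (gE j jE y)) => Z [l lD ->]; exact: gS.
apply: (gj t (fun t => V (u t))) => [|y z|Z w {}t [l lS ZE]]; first by rewrite linear0.
  by rewrite linearD; apply: VD.
move: w t; rewrite {Z}ZE => w t.
have [ls|ls] := eqVneq l s; last first.
  by apply: UV; apply: (trace_im (u \o w) t); exists l => //; rewrite !inE ls.
move: w t; rewrite {l lS}ls => w t.
apply: (Vr (u \o w)) => /linear_bij_inv[v [vK Kv]].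
have wK : cancel w (v \o u) by move=> y; apply: vK.
have Kw := indec_retract (Ts_indec j) (indec_nz (Ts_indec s)) wK.
have sj : s = j by apply: Ts_inj; exists w; exists (v \o u).
by move/pred0P: DE => /(_ s); rewrite /= sD sj jE.
Qed.
End Family.

Section Tilt.
Variables (k : fieldType) (A : falgType k) (T : lmodType A).
Hypothesis tT : tilting T.
Implicit Types X Y Z P L K Q W I : lmodType A.

Let fT : fin_gen T. Proof. by case: tT. Qed.

(** The presentation of a summand of T also has a projective syzygy, and
    Ext^1 from the summand vanishes on T(T); the Euler characteristic of
    Hom(X, -) then reduces to the dimension of Hom(X, W). *)
Lemma summand_presentation X : summand X T ->
  exists K Q, [/\ fin_gen K /\ projective K, fin_gen Q /\ projective Q
    & forall W, torsion T W -> hdim Q W = (hdim X W + hdim K W)%N].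
Proof.
move=> /summand_retract[i [p ip]].
have [r [q qS]] : exists r (q : {linear dpow (A^o : lmodType A) r -> X}), surj q.
  by apply: free_cover; apply: (fin_gen_surj (f := p)) => // x; exists (i x).
have [K [j jq]] := presentation_ex (@free_projective A r) qS.
have fQ := @free_fin_gen A r.
case: (jq) => pQ jI _ jP.
case: tT => _ /pd1_presentation[K0 [Q0 [j0 [g0 [jg0 pK0 _ _]]]]] _ _.
exists K, (dpow (A^o : lmodType A) r); split; first split.
- exact: fin_gen_inj jI fQ.
- exact: (presentation_proj ip jg0 jq pK0).
- by split.
move=> W [fW EW]; apply: (hdim_coexact fQ fW jI qS jP).
exact: (presentation_extends ip jg0 jq (Ext1_extends jg0 EW)).
Qed.

Section Reps.
Variables (n : nat) (Ts S : 'I_n -> lmodType A).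
Hypothesis TsP : forall i, indecomposable (Ts i) /\ summand (Ts i) T.
Hypothesis SP : forall X, simple_mod X -> exists i, mod_iso X (S i).

(** A linear relation among the functions dim Hom(T_i, -) on T(T). *)
Definition relation (a : 'I_n -> rat) : Prop :=
  forall X, torsion T X -> \sum_i a i * (hdim (Ts i) X)%:R = 0.

(** The matrix G of Euler characteristics of the T_i against the simple
    modules kills the multiplicity vector of Y. Being square, it also has a
    non-zero left kernel vector, and G computes dim Hom(T_i, X) for every X
    in T(T). *)
Lemma relation_ex Y : torsion T Y -> (forall f : {linear T -> Y}, forall t, f t = 0) ->
  ~ zero_mod Y -> exists2 a, relation a & exists i, a i != 0.
Proof.
move=> TY FY Y0.
have [K KP] := choice (fun i => summand_presentation (TsP i).2).
have [Q QP] := choice KP.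
pose G : 'M[rat]_n := \matrix_(i, j) ((hdim (Q i) (S j))%:R - (hdim (K i) (S j))%:R).
have GE X : torsion T X -> exists c : 'I_n -> nat,
    (forall i, (hdim (Ts i) X)%:R = \sum_j G i j * (c j)%:R) /\
    ((forall j, c j = 0%N) -> zero_mod X).
  move=> TX; have [c [cE c0]] := composition_factors SP TX.1.
  exists c; split=> // i; case: (QP i) => -[fK pK] [fQ pQ] /(_ X TX)/eqP.
  rewrite (cE (Q i)) // (cE (K i)) // => /eqP QK.
  apply: (addIr ((\sum_j c j * hdim (K i) (S j))%N%:R)).
  rewrite -natrD -QK !natr_sum -big_split /=; apply: eq_bigr => j _.
  rewrite mxE !natrM mulrBl.
  by rewrite -[in RHS](mulrC (c j)%:R) -[in X in _ = _ - X + _](mulrC (c j)%:R) subrK.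
have [c [cE c0]] := GE Y TY.
have : \det G^T == 0.
  apply/det0P; exists (\row_j (c j)%:R).
    apply/eqP => /rowP r0; apply: Y0; apply: c0 => j.
    by have := r0 j; rewrite !mxE => /eqP; rewrite pnatr_eq0 => /eqP.
  apply/rowP => i; rewrite !mxE.
  transitivity ((hdim (Ts i) Y)%:R : rat).
    by rewrite cE; apply: eq_bigr => j _; rewrite !mxE mulrC.
  rewrite hdim_zero // => f t.
  have [_ /summand_retract[u [p up]]] := TsP i.
  by rewrite -(up t); apply: (FY (f \o p)).
rewrite det_tr => /det0P[v v0 vG].
exists (v 0) => [X TX|].
  have [d [dE _]] := GE X TX.
  under eq_bigr do rewrite dE mulr_sumr.
  rewrite exchange_big big1 //= => j _.
  under eq_bigr do rewrite mulrA.
  rewrite -mulr_suml; have /rowP/(_ j) := vG; rewrite !mxE => ->.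
  by rewrite mul0r.
by apply/existsP; apply: contraNT v0 => /existsPn v0;
  apply/eqP/rowP => i; rewrite mxE; apply/eqP; have := v0 i; rewrite negbK.
Qed.

Lemma Ts_gen i : gen_by (only T) (Ts i).
Proof.
have [_ /summand_retract[u [p up]]] := TsP i => x.
by rewrite -(up x); apply: trace_im.
Qed.

Lemma fam_gen D X : gen_by (fam Ts D) X -> gen_by (only T) X.
Proof. by move=> gX x; apply: (trace_trans _ (gX x)) => Z [i _ ->]; apply: Ts_gen. Qed.

(** Let I be the trace of the T_i with a_i > 0 in T_j. Both I and T_j lie in
    T(T), and dim Hom(T_i, I) = dim Hom(T_i, T_j) when a_i > 0. Subtracting
    the relations for T_j and I leaves a sum of terms of one sign, so all
    terms vanish; the one for j says that the identity of T_j factors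
    through I. *)
Lemma relation_gen a j : relation a -> a j < 0 ->
  gen_by (fam Ts [set i | 0 < a i]) (Ts j).
Proof.
move=> ra aj; set D := [set i | _].
have [I [u [uI uP gI]]] := trace_ex (fam Ts D) (Ts j).
have fj : fin_gen (Ts j) by apply/indec_fg; case: (TsP j).
have fI := fin_gen_inj uI fj.
have tI : torsion T I := gen_torsion tT fI (fam_gen gI).
have tj : torsion T (Ts j) := gen_torsion tT fj (@Ts_gen j).
have fi i : fin_gen (Ts i) by apply/indec_fg; case: (TsP i).
have postI i : injective (khom_post (Ts i) u).
  move=> f g /= E; apply: homP => x; apply: uI.
  exact: (congr1 (fun h : khom (Ts i) (Ts j) => h x) E).
have le i : (hdim (Ts i) I <= hdim (Ts i) (Ts j))%N.
  by apply: (dimk_inj (postI i)); apply: khom_findim.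
have eqD i : 0 < a i -> hdim (Ts i) I = hdim (Ts i) (Ts j).
  move=> ai; apply: (dimk_iso (f := khom_post (Ts i) u)); last exact: khom_findim.
  apply: inj_surj_bij (postI i) _ => f.
  have [|g gE] := @lift_along_inj A (Ts j) (Ts i) I u f uI.
    by move=> t; apply/uP; apply: trace_im; exists i; rewrite ?inE.
  by exists g; apply: homP => x /=.
(* Each term is non-negative: it vanishes if a_i > 0, and Hom(T_i, I) embeds
   in Hom(T_i, T_j) otherwise. *)
have : \sum_i - a i * ((hdim (Ts i) (Ts j))%:R - (hdim (Ts i) I)%:R) = 0.
  under eq_bigr do rewrite mulrBr !mulNr.
  by rewrite sumrB !sumrN (ra _ tj) (ra _ tI) !oppr0 subrr.
move/psumr_eq0P => /(_ _ j isT) Ej.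
have {Ej} /eqP : - a j * ((hdim (Ts j) (Ts j))%:R - (hdim (Ts j) I)%:R) = 0.
  apply: Ej => i _; have [ai|ai] := ltP 0 (a i); first by rewrite eqD // subrr mulr0.
  by rewrite mulr_ge0 ?oppr_ge0 // subr_ge0 ler_nat.
rewrite mulf_eq0 oppr_eq0 (lt_eqF aj) /= subr_eq0 eqr_nat => /eqP E x.
have [||g gE] := dimk_inj_surj (postI j) _ _ (idfun : {linear Ts j -> Ts j}).
- exact: khom_findim.
- by rewrite -/(hdim _ _) E.
- by apply/uP; exists (g x); exact: (congr1 (fun h : khom (Ts j) (Ts j) => h x) gE).
Qed.
End Reps.

(** Applied to a relation and to its opposite, [relation_gen] makes the T_i
    with positive and with negative coefficients generate each other. *)
Lemma torsion_free_torsion_zero Y : torsion T Y ->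
  (forall f : {linear T -> Y}, forall t, f t = 0) -> zero_mod Y.
Proof.
move=> TY FY; apply: contrapT => Y0.
have [_ _ _ [n [[Ts [TsP Ts_inj _]] [S [_ _ SP]]]]] := tT.
have [a ra [i ai]] := relation_ex TsP SP TY FY Y0.
have Tsi j : indecomposable (Ts j) by case: (TsP j).
have ra' : relation Ts (fun i => - a i).
  by move=> X TX; under eq_bigr do rewrite mulNr; rewrite sumrN ra // oppr0.
pose D := [set i | 0 < a i]; pose E := [set i | 0 < - a i].
have gD j : j \in D -> gen_by (fam Ts E) (Ts j).
  by rewrite inE => aj; apply: (relation_gen TsP ra'); rewrite oppr_lt0.
have gE j : j \in E -> gen_by (fam Ts D) (Ts j).
  by rewrite inE oppr_gt0 => aj; apply: (relation_gen TsP ra).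
have DE : [disjoint D & E].
  by apply/pred0P => j; rewrite !inE oppr_gt0; case: ltgtP.
have ED : [disjoint E & D] by rewrite disjoint_sym.
have D0 := fam_mutual_gen Tsi Ts_inj DE gD gE.
have E0 := fam_mutual_gen Tsi Ts_inj ED gE gD.
move: ai; rewrite neq_lt => /orP[ai|ai].
  by move/setP/(_ i): E0; rewrite !inE oppr_gt0 ai.
by move/setP/(_ i): D0; rewrite !inE ai.
Qed.

Theorem torsion_gen X : torsion T X -> gen_by (only T) X.
Proof.
move=> TX x; have [Z [q [qS qP]]] := quotient_ex (trace_submodule (only T) X).
apply/qP; apply: torsion_free_torsion_zero; first exact: torsion_quot tT _ _ _ qS TX.
exact: (trace_quot_free tT TX.1 qS qP).
Qed.
End Tilt.

(** * The functor Hom(T, -) on the torsion class *)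

Section HomT.
Variables (R : pzRingType) (T : lmodType R).
Implicit Types X Y Z : lmodType R.

Lemma hom_sumE X (I : Type) (r : seq I) (F : I -> homR T X) t :
  (\sum_(i <- r) F i : homR T X) t = \sum_(i <- r) F i t.
Proof. by elim: r => [|i r IH]; rewrite ?big_nil // !big_cons /= -IH. Qed.

Lemma hom_gensE X r (u : 'I_r -> homR T X) (w : 'I_r -> endo T) (v : homR T X) :
  (forall t, v t = \sum_i u i (w i t)) -> v = \sum_i ((w i : (endo T)^c) *: u i).
Proof. by move=> vE; apply: homP => t; rewrite vE hom_sumE. Qed.

Lemma dpow_in_gens r : hom_gens (fun i : 'I_r => dpow_in T i).
Proof.
move=> v; exists (fun i => dpow_pr T i \o v : {linear T -> T}) => t.
exact: dpow_sum.
Qed.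

Lemma hom_map_comp X Y Z (f : {linear X -> Y}) (g : {linear Y -> Z}) h :
  hom_map T (g \o f) h = hom_map T g (hom_map T f h).
Proof. by apply: homP. Qed.

(** F(T^r) is free of rank r over End(T), with basis the inclusions [dpow_in
    T i]. *)
Lemma hom_dpow_projective r : projective (homR T (dpow T r)).
Proof.
move=> Y Z g f gS.
have [y yP] := choice (fun i : 'I_r => gS (f (dpow_in T i))).
have lh : linear (fun w : homR T (dpow T r) =>
    \sum_i ((dpow_pr T i \o w : {linear T -> T}) : (endo T)^c) *: y i).
  move=> b w w'; rewrite scaler_sumr -big_split /=; apply: eq_bigr => i _.
  rewrite scalerA -scalerDl; congr (_ *: _).
  by apply: homP => t /=; rewrite !ffunE.
exists (mk_linear lh) => w /=; rewrite linear_sum /=.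
rewrite [in LHS](hom_gensE (u := fun i => dpow_in T i)
  (w := fun i => dpow_pr T i \o w : {linear T -> T}) (v := w)).
  by rewrite linear_sum; apply: eq_bigr => i _; rewrite !linearZ /= yP.
by move=> t; exact: dpow_sum.
Qed.

Lemma hom_gens_fin_gen X r (u : 'I_r -> homR T X) : hom_gens u -> fin_gen (homR T X).
Proof.
move=> uP; exists r, u => v; have [w vE] := uP v.
by exists w; exact: hom_gensE.
Qed.

Lemma hom_gens_surj X r (u : 'I_r -> homR T X) : hom_gens u -> gen_by (only T) X ->
  surj (dpow_copair u).
Proof.
move=> uP gX x; apply: (gX x (fun x => exists t, dpow_copair u t = x)).
- by exists 0; rewrite linear0.
- by move=> _ _ [t <-] [t' <-]; exists (t + t'); rewrite linearD.
- move=> Z v t ZT; move: v t; rewrite ZT => v t; have [w vE] := uP v.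
  exists [ffun i => w i t] => /=; rewrite vE.
  by apply: eq_bigr => i _; rewrite ffunE.
Qed.

Lemma hom_faithful X Y (f g : {linear X -> Y}) : gen_by (only T) X ->
  (forall h, hom_map T f h = hom_map T g h) -> forall x, f x = g x.
Proof.
move=> gX fg x; apply: (gX x (fun x => f x = g x)); first by rewrite !linear0.
  by move=> y z fy fz; rewrite !linearD /= fy fz.
move=> Z u t ZT; move: u t; rewrite ZT => u t.
exact: (congr1 (fun h : homR T Y => h t) (fg u)).
Qed.

Section Eval.
Variable X : lmodType R.
Let tensX := tensor (homR T X) (endo_mod T).
(** The counit Hom(T, X) (x) T -> X of the tensor-hom adjunction. *)
Definition ev : tensX -> X := @tensor_lift (endo T) (homR T X) (endo_mod T) X (fun w t => w t).
Lemma ev_pi s : ev (tensor_pi s) = \sum_(p <- s) (p.1 : homR T X) p.2.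
Proof.
apply: tensor_liftE => // w t t'; exact: linearD.
Qed.
Lemma evD x y : ev (x + y) = ev x + ev y.
Proof.
by rewrite -(tensor_repr x) -(tensor_repr y) [_ + _]tensor_addE !ev_pi big_cat.
Qed.
Lemma ev_tens w t : ev (tens w t) = (w : homR T X) t.
Proof. by rewrite /tens ev_pi big_seq1. Qed.
Lemma ev0 : ev 0 = 0.
Proof. by rewrite [0 in LHS](erefl : _ = tensor_pi [::]) ev_pi big_nil. Qed.
Lemma ev_sum (I : Type) (r : seq I) (F : I -> tensX) :
  ev (\sum_(i <- r) F i) = \sum_(i <- r) ev (F i).
Proof. by apply: big_morph; [exact: evD|exact: ev0]. Qed.
Lemma tens_sum_l (I : Type) (r : seq I) (F : I -> homR T X) (t : endo_mod T) :
  tens (\sum_(i <- r) F i) t = \sum_(i <- r) tens (F i) t :> tensX.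
Proof.
apply: (big_morph (fun w => tens w t)) => [w w'|]; first exact: tensDl.
exact: tens0.
Qed.
End Eval.

Lemma ev_map X Y (f : {linear X -> Y}) x :
  ev (tensor_map (hom_map T f) x) = f (ev x).
Proof.
rewrite -(tensor_repr x) tensor_mapE ev_sum ev_pi linear_sum.
by apply: eq_bigr => p _; rewrite ev_tens.
Qed.

Section EvPow.
Variable r : nat.
(** On T^r the counit is bijective, because F(T^r) is free on the
    inclusions. *)
Definition ev_inv (t : dpow T r) : tensor (homR T (dpow T r)) (endo_mod T) :=
  \sum_i tens (dpow_in T i : homR T (dpow T r)) (t i : endo_mod T).
Lemma ev_invD t t' : ev_inv (t + t') = ev_inv t + ev_inv t'.
Proof.
by rewrite /ev_inv -big_split; apply: eq_bigr => i _; rewrite ffunE; exact: tensDr.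
Qed.
Lemma ev_inv0 : ev_inv 0 = 0.
Proof. by apply: (addrI (ev_inv 0)); rewrite -ev_invD !addr0. Qed.
Lemma ev_invK : cancel ev_inv (@ev (dpow T r)).
Proof.
move=> t; rewrite ev_sum [RHS]dpow_sum; apply: eq_bigr => i _; exact: ev_tens.
Qed.
Lemma evK : cancel (@ev (dpow T r)) ev_inv.
Proof.
move=> x; rewrite -(tensor_repr x); elim: (repr x) => [|[w t] s IH].
  by rewrite ev_pi big_nil ev_inv0.
rewrite -cat1s -[tensor_pi _]tensor_addE evD ev_invD IH; congr (_ + _).
rewrite -[tensor_pi _]/(tens w t) ev_tens.
transitivity (tens (\sum_i ((dpow_pr T i \o w : {linear T -> T}) : (endo T)^c) *:
  (dpow_in T i : homR T (dpow T r))) t); last first.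
  congr (tens _ t); apply/esym/hom_gensE => t'; exact: dpow_sum.
by rewrite tens_sum_l; apply: eq_bigr => i _; rewrite tensZ.
Qed.
End EvPow.
End HomT.

Section Functor.
Variables (k : fieldType) (A : falgType k) (T : lmodType A).
Hypothesis tT : tilting T.
Implicit Types X Y Z P L K Q W I : lmodType A.

Lemma hom_fin_gen X : fin_gen X -> fin_gen (homR T X).
Proof. by move=> /(fin_gen_hom_gens tT)[r [u uP]]; apply: hom_gens_fin_gen uP. Qed.

(** X is the cokernel of T^s -> T^r for suitable r and s. A morphism phi
    prescribes the images of the r generators of X, and it respects the
    relations because those come from maps T -> T^r with zero image in
    Hom(T, X). *)
Lemma hom_full X Y (phi : {linear homR T X -> homR T Y}) : torsion T X ->
  exists f : {linear X -> Y}, forall h, phi h = hom_map T f h.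
Proof.
move=> TX; have [r [u uP]] := fin_gen_hom_gens tT TX.1.
have uS := hom_gens_surj uP (torsion_gen tT TX).
have [L [j [jI jP]]] := kernel_ex (dpow_copair u).
have TL := torsion_kernel tT uP jI jP.
have [|f fE] := @factor_through_surj A (dpow T r) Y X (dpow_copair u)
    (dpow_copair (fun i => phi (u i))) uS.
  move=> _ /jP[y <-].
  have gL : gen_by (only T) L by exact: torsion_gen.
  apply: (gL y (fun y => dpow_copair (fun i => phi (u i)) (j y) = 0)).
  - by rewrite !linear0.
  - by move=> y1 y2 e1 e2; rewrite !linearD /=; move: e1 e2 => /= -> ->; rewrite addr0.
  - move=> Z v t ZT; move: v t; rewrite ZT => {Z ZT} v t.
    pose w i : endo T := dpow_pr T i \o (j \o v : {linear T -> dpow T r}) : {linear T -> T}.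
    have w0 : 0 = \sum_i ((w i : (endo T)^c) *: u i).
      apply: hom_gensE => t' /=; apply/esym; rewrite -[LHS]/(dpow_copair u (j (v t'))).
      by apply/jP; exists (v t').
    have : phi 0 = 0 by rewrite linear0.
    rewrite {1}w0 linear_sum => /(congr1 (fun h : homR T Y => h t)).
    rewrite hom_sumE => E; rewrite -[RHS]E /=; apply: eq_bigr => i _.
    by rewrite linearZ.
exists f => h; have [w hE] := uP h.
rewrite [in LHS](hom_gensE hE) linear_sum; apply: homP => t.
rewrite hom_sumE /= hE linear_sum; apply: eq_bigr => i _; rewrite linearZ /=.
have -> : u i (w i t) = dpow_copair u (dpow_in T i (w i t)).
  rewrite /= (bigD1 i) //= big1 ?ffunE ?eqxx ?addr0 // => l li.
  by rewrite ffunE (negPf li) linear0.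
rewrite fE /= (bigD1 i) //= big1 ?ffunE ?eqxx ?addr0 // => l li.
by rewrite ffunE (negPf li) linear0.
Qed.

Lemma hom_indecomposable X : indecomposable X -> torsion T X -> indecomposable (homR T X).
Proof.
move=> Xi TX; have gX : gen_by (only T) X by exact: torsion_gen.
apply: indec_of_idem; first exact: hom_fin_gen TX.1.
  move=> F0; apply: (indec_nz Xi) => x.
  apply: (gX x (fun x => x = 0)) => // [_ _ -> ->|Z u t ZT]; first exact: addr0.
  by move: u t; rewrite ZT => u t; exact: (congr1 (fun h : homR T X => h t) (F0 u)).
move=> e ee; have [f fE] := hom_full e TX.
have [|f1|f0] := indec_idem (e := f) Xi.
- apply: (hom_faithful (f := f \o f) gX) => h.
  by rewrite hom_map_comp -!fE ee.
- by left=> h; rewrite fE; apply: homP => t /=.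
- by right=> h; rewrite fE; apply: homP => t /=.
Qed.

(** If h' F(f) h were bijective, then h would be bijective as F(X) is
    indecomposable, and F(f) would have a left inverse; by fullness and
    faithfulness so would f, contradicting radicality. *)
Lemma hom_radical X Y (f : {linear X -> Y}) : indecomposable X -> torsion T X ->
  torsion T Y -> radical f -> radical (hom_map T f).
Proof.
move=> Xi TX TY fR L h h' Li /linear_bij_inv[v [vK Kv]].
have hK : cancel h (v \o h' \o hom_map T f) by move=> y; exact: vK.
have Kh := indec_retract (hom_indecomposable Xi TX) (indec_nz Li) hK.
have [g gE] := hom_full (h \o v \o h') TY.
have gf x : (g \o f) x = x.
  apply: (hom_faithful (f := g \o f) (g := idfun) (torsion_gen tT TX)) => w.
  rewrite hom_map_comp -gE; have := Kh w => /= ->.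
  by apply: homP.
by apply: (fR X idfun g Xi); exists idfun => x /=; rewrite -[LHS]/((g \o f) x) gf.
Qed.

(** A module of T(T) with generators of its Hom from T: the state from which
    the next step of the resolution by powers of T is chosen. *)
Record tpres := TPres {
  tp_mod : lmodType A;
  tp_torsion : torsion T tp_mod;
  tp_rank : nat;
  tp_gens : 'I_tp_rank -> homR T tp_mod;
  tp_gensP : hom_gens tp_gens
}.

Definition tp_map (s : tpres) := dpow_copair (@tp_gens s).

Lemma tp_map_surj s : surj (tp_map s).
Proof. by apply: (hom_gens_surj (@tp_gensP s)); apply: torsion_gen => //; apply: tp_torsion. Qed.

Lemma tpres_ex X : torsion T X -> exists s, tp_mod s = X.
Proof.
move=> TX; have [r [u uP]] := fin_gen_hom_gens tT TX.1.
by exists (TPres TX uP).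
Qed.

Lemma tp_next_ex (s : tpres) : exists p : {s' : tpres & {linear tp_mod s' -> dpow T (tp_rank s)}},
  injective (projT2 p) /\ forall x, tp_map s x = 0 <-> exists y, projT2 p y = x.
Proof.
have [L [j [jI jP]]] := kernel_ex (tp_map s).
have TL := torsion_kernel tT (@tp_gensP s) jI jP.
have [s' E] := tpres_ex TL; subst L.
by exists (existT _ s' j).
Qed.

Definition tp_next s := projT1 (sval (cid (tp_next_ex s))).
Definition tp_ker s : {linear tp_mod (tp_next s) -> dpow T (tp_rank s)} :=
  projT2 (sval (cid (tp_next_ex s))).
Lemma tp_ker_inj s : injective (tp_ker s).
Proof. by case: (svalP (cid (tp_next_ex s))). Qed.
Lemma tp_kerP s x : tp_map s x = 0 <-> exists y, tp_ker s y = x.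
Proof. by case: (svalP (cid (tp_next_ex s))). Qed.

Section Resolution.
Variable s0 : tpres.
Definition tp_iter n := iter n tp_next s0.
Definition tp_diff n : {linear dpow T (tp_rank (tp_iter n.+1)) -> dpow T (tp_rank (tp_iter n))} :=
  tp_ker (tp_iter n) \o tp_map (tp_iter n.+1).

Lemma tp_map_lift s (v : homR T (tp_mod s)) :
  exists w, hom_map T (tp_map s) w = v.
Proof.
have [w wE] := tp_gensP v; exists (dpow_pair w); apply: homP => t /=.
by rewrite wE; apply: eq_bigr => i _; rewrite ffunE.
Qed.

Lemma tp_exact s (h : homR T (dpow T (tp_rank s))) :
  hom_map T (tp_map s) h = 0 <->
  exists z, hom_map T (tp_ker s \o tp_map (tp_next s)) z = h.
Proof.
split=> [h0|[z <-]]; last first.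
  apply: homP => t; apply/tp_kerP; by eexists.
have [g gE] : exists g : {linear T -> tp_mod (tp_next s)}, forall t, tp_ker s (g t) = h t.
  apply: lift_along_inj; first exact: tp_ker_inj.
  by move=> t; apply/tp_kerP; exact: (congr1 (fun h : homR T _ => h t) h0).
have [z zE] := tp_map_lift (g : homR T _).
exists z; rewrite hom_map_comp zE; apply: homP => t; exact: gE.
Qed.

Lemma tp_diff_exact n (h : homR T (dpow T (tp_rank (tp_iter n.+1)))) :
  hom_map T (tp_diff n) h = 0 <-> exists z, hom_map T (tp_diff n.+1) z = h.
Proof.
rewrite -tp_exact hom_map_comp; split=> [E|->]; last by rewrite linear0.
apply: homP => t; apply: (@tp_ker_inj (tp_iter n)).
by rewrite linear0; exact: (congr1 (fun h : homR T _ => h t) E).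
Qed.

Definition tp_resolution : proj_resolution (homR T (tp_mod s0)) :=
  @ProjResolution _ _ (fun n => homR T (dpow T (tp_rank (tp_iter n))))
    (fun n => hom_map T (tp_diff n)) (hom_map T (tp_map s0))
    (fun n => hom_gens_fin_gen (@dpow_in_gens _ T _))
    (fun n => @hom_dpow_projective _ T _)
    (@tp_map_lift s0) (@tp_exact s0) tp_diff_exact.

(** Tensoring F(T^r) with T gives back T^r naturally, so exactness of the
    tensored complex is exactness of the resolution of X by powers of T. *)
Lemma tp_Tor : Tor1_zero (homR T (tp_mod s0)) (endo_mod T).
Proof.
exists tp_resolution => x /= x0.
have d0 : tp_diff 0 (ev x) = 0 by rewrite -ev_map x0 ev0.
have /tp_kerP[y yE] : tp_map (tp_iter 1) (ev x) = 0.
  by apply: (@tp_ker_inj (tp_iter 0)); rewrite linear0.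
have [t tE] := @tp_map_surj (tp_iter 2) y.
exists (ev_inv t); rewrite -[RHS]evK -[LHS]evK; congr ev_inv.
by rewrite ev_map ev_invK -[LHS]/(tp_ker (tp_iter 1) (tp_map (tp_iter 2) t)) tE yE.
Qed.
End Resolution.

Lemma hom_torsion_freeB X : torsion T X -> torsion_freeB (homR T X : lmodType (endo T)^c).
Proof.
move=> TX; split; first exact: hom_fin_gen TX.1.
by have [s <-] := tpres_ex TX; apply: tp_Tor.
Qed.
End Functor.

(** * Powers of the radical and paths of irreducible morphisms *)

Section RadPow.
Variable R : pzRingType.
Implicit Types X Y Z W L : lmodType R.

Lemma radical_post X Y Z (f : {linear X -> Y}) (a : {linear Y -> Z}) :
  radical f -> radical (a \o f).
Proof. by move=> fR M h h' Mi; apply: (fR M h (h' \o a) Mi). Qed.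

Lemma radical_pre X Y Z (f : {linear X -> Y}) (b : {linear Z -> X}) :
  radical f -> radical (f \o b).
Proof. by move=> fR M h h' Mi; apply: (fR M (b \o h) h' Mi). Qed.

Lemma rad_pow_post n X Y Z (f : {linear X -> Y}) (a : {linear Y -> Z}) :
  rad_pow n f -> rad_pow n (a \o f).
Proof.
case: n => [|[|n]] //= fR; first exact: radical_post.
case: fR => q [W [h [g [P fE]]]]; exists q, W, h, (fun i => a \o g i).
split=> [i|x]; last by rewrite /= fE linear_sum.
by have [fW hR gR] := P i; split=> //; exact: radical_post.
Qed.

Lemma rad_pow_comp1 n X Y Z (f : {linear X -> Y}) (g : {linear Y -> Z}) :
  fin_gen Y -> rad_pow n.+1 f -> radical g -> rad_pow n.+2 (g \o f).
Proof.
move=> fY fR gR; exists 1%N, (fun=> Y), (fun=> f), (fun=> g); split=> // x.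
by rewrite big_ord1.
Qed.

Lemma rad_pow_comp n m X Y Z (f : {linear X -> Y}) (g : {linear Y -> Z}) :
  fin_gen Y -> rad_pow n.+1 f -> rad_pow m.+1 g -> rad_pow (n + m).+2 (g \o f).
Proof.
elim: m Z g => [|m IH] Z g fY fR gR.
  by rewrite addn0; apply: rad_pow_comp1.
case: gR => q [W [h [g' [P gE]]]].
exists q, W, (fun i => h i \o f), g'; split=> [i|x]; last by rewrite /= gE.
by have [fW hR gR] := P i; split=> //; rewrite addnS; apply: IH.
Qed.

Lemma rad_pow_eq n X Y (f g : {linear X -> Y}) : f =1 g -> rad_pow n f -> rad_pow n g.
Proof. by move=> /linear_ext ->. Qed.

Lemma rad_pow0 n X Y (f : {linear X -> Y}) : (forall x, f x = 0) -> rad_pow n.+2 f.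
Proof.
move=> f0; exists 0%N, (fun=> X), (fun=> idfun), (fun=> f); split=> [[]//|x].
by rewrite big_ord0.
Qed.

(** The square and the higher powers are closed under sums simply by
    concatenation; for the radical itself local endomorphism rings would be
    required, hence the shift by 2. *)
Lemma rad_powD n X Y (f g h : {linear X -> Y}) : rad_pow n.+2 f -> rad_pow n.+2 g ->
  (forall x, h x = f x + g x) -> rad_pow n.+2 h.
Proof.
case=> q [W [a [b [P fE]]]] [q' [W' [a' [b' [P' gE]]]]] hE.
pose F (i : 'I_(q + q')) : {V : lmodType R & ({linear X -> V} * {linear V -> Y})%type} :=
  match split i with
  | inl l => existT _ (W l) (a l, b l)
  | inr l => existT _ (W' l) (a' l, b' l)
  end.
exists (q + q')%N, (fun i => projT1 (F i)), (fun i => (projT2 (F i)).1),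
  (fun i => (projT2 (F i)).2).
split=> [i|x]; first by rewrite /F; case: (split i) => l; [exact: P|exact: P'].
rewrite hE fE gE big_split_ord /=; congr (_ + _); apply: eq_bigr => i _; rewrite /F.
  by rewrite (unsplitK (inl i)).
by rewrite (unsplitK (inr i)).
Qed.

Lemma rad_pow_sum n X Y (C : {linear X -> Y} -> Prop) f :
  (forall c, C c -> rad_pow n.+2 c) -> sum_of C f -> rad_pow n.+2 f.
Proof.
move=> CR; elim=> {f} [f f0|f g h Cg _ IH fE]; first exact: rad_pow0.
exact: (rad_powD (CR _ Cg) IH fE).
Qed.

Lemma radical_not_split_mono X Y (f : {linear X -> Y}) : indecomposable X ->
  radical f -> ~ split_mono f.
Proof.
move=> Xi fR [r rK]; apply: (fR X idfun r Xi).
by exists idfun => x /=; rewrite rK.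
Qed.

Lemma radical_not_split_epi X Y (f : {linear X -> Y}) : indecomposable Y ->
  radical f -> ~ split_epi f.
Proof.
move=> Yi fR [s sK]; apply: (fR Y s idfun Yi).
by exists idfun => x /=; rewrite sK.
Qed.

Lemma not_split_mono_radical X Y (f : {linear X -> Y}) : indecomposable X ->
  ~ split_mono f -> radical f.
Proof.
move=> Xi fN L h h' Li /linear_bij_inv[v [vK Kv]]; apply: fN.
have hK : cancel h (v \o h' \o f) by move=> y; exact: vK.
have Kh := indec_retract Xi (indec_nz Li) hK.
by exists (h \o v \o h').
Qed.

Lemma not_split_epi_radical X Y (f : {linear X -> Y}) : indecomposable Y ->
  ~ split_epi f -> radical f.
Proof.
move=> Yi fN L h h' Li /linear_bij_inv[v [vK Kv]]; apply: fN.
have hK : cancel (f \o h \o v) h' by move=> y; exact: Kv.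
have Kh := indec_retract Yi (indec_nz Li) hK.
by exists (h \o v \o h') => y; exact: Kh.
Qed.

(** In a factorization g h of f through Z, h is radical unless it is a split
    monomorphism and g is radical unless it is a split epimorphism; if
    neither splits, g h is in the square of the radical. *)
Lemma radical_irreducible X Y (f : {linear X -> Y}) :
  indecomposable X -> indecomposable Y ->
  radical f -> irreducible_mor f \/ rad_pow 2 f.
Proof.
move=> Xi Yi fR; have [|f2] := pselect (rad_pow 2 f); first by right.
left; split; [exact: radical_not_split_mono|exact: radical_not_split_epi|].
move=> Z h g fZ fE; have [|hN] := pselect (split_mono h); first by left.
right; apply: contrapT => gN; apply: f2.
apply: (rad_pow_eq (f := g \o h)); first by move=> x; rewrite fE.
apply: rad_pow_comp1 => //; [exact: not_split_mono_radical|exact: not_split_epi_radical].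
Qed.

Lemma irr_path_ends (C : lmodType R -> Prop) n X Y (f : {linear X -> Y}) :
  irr_path C n f -> C X /\ C Y.
Proof. by elim=> [? ?|? ? ? ? ? ? ? ? _ []]. Qed.

(** Paths are built by adding an arrow at the source, powers of the radical
    by adding a factor at the target. *)
Lemma irr_path_rcons (C : lmodType R -> Prop) n X Y Z (f : {linear X -> Y}) (g : {linear Y -> Z}) :
  irr_path C n f -> C Z -> irreducible_mor g -> irr_path C n.+1 (g \o f : {linear X -> Z}).
Proof.
move=> p; elim: p Z g => {n X Y f} [X CX|n X W Y f h CX fI hp IH] Z g CZ gI.
  have -> : (g \o idfun : {linear X -> Z}) = (idfun \o g : {linear X -> Z}) by apply: linear_ext.
  exact: (IrrPathS CX gI (IrrPath0 CZ)).
have -> : (g \o (h \o f) : {linear X -> Z}) = ((g \o h) \o f : {linear X -> Z}) by apply: linear_ext.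
exact: (IrrPathS CX fI (IH _ _ CZ gI)).
Qed.

Lemma irreducible_radical X Y (f : {linear X -> Y}) : indecomposable X ->
  irreducible_mor f -> radical f.
Proof. by move=> Xi [fN _ _]; apply: not_split_mono_radical. Qed.

Lemma irr_path_rad_pow (C : lmodType R -> Prop) n X Y (f : {linear X -> Y}) :
  (forall X, C X -> indecomposable X) -> irr_path C n f -> rad_pow n f.
Proof.
move=> Ci; elim=> {n X Y f} [//|[|n] X W Y f h CX fI hp IH].
  apply: (@rad_pow_post 1) => /=; exact: irreducible_radical (Ci _ CX) fI.
have fW := indec_fg (Ci _ (irr_path_ends hp).1).
exact: (rad_pow_comp (n := 0) fW (irreducible_radical (Ci _ CX) fI : rad_pow 1 f) IH).
Qed.
End RadPow.

Section Main.
Variables (k : fieldType) (A : falgType k) (T : lmodType A).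
Hypotheses (tT : tilting T) (sT : separating T).
Implicit Types X Y Z P L K Q W I : lmodType A.

Let C (Y : lmodType (endo T)^c) := indecomposable Y /\ torsion_freeB Y.

Let CF X : indecomposable X -> torsion T X -> C (homR T X).
Proof. by move=> Xi TX; split; [exact: hom_indecomposable|exact: hom_torsion_freeB]. Qed.

(** The identities of the intermediate modules are split into indecomposable
    components. *)
Lemma rad_pow_indec n X Y (f : {linear X -> Y}) : rad_pow n.+2 f ->
  sum_of (fun c => exists L (h : {linear X -> L}) (g : {linear L -> Y}),
    [/\ indecomposable L, rad_pow n.+1 h, radical g & c =1 g \o h]) f.
Proof.
case=> q [W [h [g [P fE]]]].
apply: (@sum_of_big _ _ _ _ _ (fun i => g i \o h i)) => // i.
have [fW hR gR] := P i.
have -> : (g i \o h i : {linear X -> Y}) = (g i \o (idfun : {linear W i -> W i}) \o h i : {linear X -> Y}).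
  by apply: linear_ext.
apply: sum_of_comp (decomposition fW) => c [L [u [p [Li cE]]]]; apply: sum_of1.
exists L, (p \o h i), (g i \o u); split=> //.
- exact: rad_pow_post.
- exact: radical_pre.
- by move=> x /=; rewrite cE.
Qed.

(** Induction on n through the last factor g of each composite: a path
    followed by F(g) is a longer path if F(g) is irreducible, and gains an
    extra power of the radical if F(g) is in the square of the radical. *)
Theorem hom_map_paths n X Y (f : {linear X -> Y}) :
  indecomposable X -> indecomposable Y -> torsion T X -> torsion T Y ->
  rad_pow n.+1 f ->
  sum_of (fun c => rad_pow n.+1 c /\ (irr_path C n.+1 c \/ rad_pow n.+2 c)) (hom_map T f).
Proof.
elim: n X Y f => [|n IH] X Y f Xi Yi TX TY fR.
  apply: sum_of1.
  have FfR := hom_radical tT Xi TX TY fR.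
  split=> //; have [FX FY] := (CF Xi TX, CF Yi TY).
  have [FfI|] := radical_irreducible FX.1 FY.1 FfR; last by right.
  left; have -> : hom_map T f = (idfun \o hom_map T f : {linear homR T X -> homR T Y}).
    by apply: linear_ext.
  exact: (IrrPathS FX FfI (IrrPath0 FY)).
apply: (sum_of_map (F := @hom_map _ T X Y)) (rad_pow_indec fR) => {f fR}.
- by move=> f f0 h; apply: homP => t /=; rewrite f0.
- by move=> f g h fE w; apply: homP => t /=; rewrite fE.
move=> c [L [h [g [Li hR gR cE]]]].
have -> : hom_map T c = (hom_map T g \o hom_map T h : {linear homR T X -> homR T Y}).
  by apply: linear_ext => w; apply: homP => t; exact: cE.
(* If L is torsion-free, F(L) = 0 and the composite is killed. *)
have [TL|[_ FL]] := sT Li; last first.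
  apply: SumOf0 => w /=; rewrite (FL (hom_map T h w)); exact: linear0.
have FL := CF Li TL; have FX := CF Xi TX; have FY := CF Yi TY.
have FgR := hom_radical tT Li TL TY gR.
have -> : (hom_map T g \o hom_map T h : {linear homR T X -> homR T Y}) =
   (hom_map T g \o hom_map T h \o (idfun : {linear homR T X -> homR T X})
     : {linear homR T X -> homR T Y}).
  by apply: linear_ext.
apply: sum_of_comp (IH _ _ _ Xi Li TX TL hR) => {c cE} c [cR cP]; apply: sum_of1.
have -> : (hom_map T g \o c \o idfun : {linear homR T X -> homR T Y}) =
  (hom_map T g \o c : {linear homR T X -> homR T Y}) by apply: linear_ext.
have fgL := indec_fg FL.1.
split; first exact: rad_pow_comp1.
case: cP => [cp|{}cR]; last by right; apply: rad_pow_comp1.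
have [gI|g2] := radical_irreducible FL.1 FY.1 FgR.
  by left; apply: irr_path_rcons.
right; have := rad_pow_comp (n := n) (m := 1) fgL (irr_path_rad_pow (fun _ => @proj1 _ _) cp) g2.
by rewrite addn1.
Qed.
End Main.

Theorem proposition2p1 (k : closedFieldType) (A : falgType k)
    (T M N : lmodType A) (f : {linear M -> N}) (n : nat) :
  basic A -> tilting T -> separating T ->
  indecomposable M -> indecomposable N -> torsion T M -> torsion T N ->
  (1 <= n)%N -> rad_pow n f ->
  rad_pow n (hom_map T f) /\
  (depth (hom_map T f) (Some n) ->
   exists g : {linear homR T M -> homR T N},
     irr_path (fun Y => indecomposable Y /\ torsion_freeB Y) n g /\
     ~ (forall h, g h = 0)).
Proof.
case: n => // n _ tT sT Mi Ni TM TN _ fR.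
have S := hom_map_paths tT sT Mi Ni TM TN fR.
split.
  case: n fR S => [|n] fR S; first exact: hom_radical.
  by apply: rad_pow_sum S => c [].
case=> _ fN; apply: contrapT => nog; apply: fN.
apply: rad_pow_sum S => c [_ [cp|//]].
have [c0|c0] := pselect (forall h, c h = 0); first exact: rad_pow0.
by case: nog; exists c.
Qed.
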